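(* Let $\gamma\in(0,1)$, let $m_\psi:\mathcal{Z}\to\mathbb{R}$ be a bounded function and let $k_\psi:\mathcal{Z}\times\mathcal{Z}\to\mathbb{R}$ be a bounded positive definite kernel on $\mathcal{Z}=\mathcal{S}\times\mathcal{A}$. Let the reward $r$ follow a Gaussian process on $\mathcal{Z}$, $r\sim\mathcal{GP}(m_\psi,k_\psi)$. For an episode $e=(z_t)_{t\ge0}$ and a time $t$ let $R_t(e)=\sum_{u\ge t}\gamma^{u-t}r(z_u)$. Then the functional \[ \hat{F}_{\mathcal{GP}}(e)=\sum_{t\ge0}\gamma^t\left(R_t(e)-\mathbb{E}_{\mathcal{GP}}[R_t(e)]\right) \] (with infinite sums converging in $L^2(\mathcal{GP})$ when the episode is infinite) follows a centered Gaussian process, indexed by episodes, with covariance kernel \[ K(e,e')=\sum_{t,u\ge0}(1+t)(1+u)\gamma^{t+u}k_\psi(z_t,z'_u), \] for episodes $e=(z_t)_{t\ge0}$, $e'=(z'_u)_{u\ge0}$.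
   Context: $\mathcal{S}$ (states) and $\mathcal{A}$ (actions) are sets, and $\mathcal{Z}:=\mathcal{S}\times\mathcal{A}$. An episode is a sequence $e=(z_t)_{t\ge0}$ with $z_t=(s_t,a_t)\in\mathcal{Z}$, which may be finite or infinite; for a finite episode, all sums over times range only over the times at which the episode is defined. $\gamma$ is a discount rate and $R_t(e)$ is the discounted return at time $t$. A Gaussian process $r\sim\mathcal{GP}(m_\psi,k_\psi)$ on $\mathcal{Z}$ is a random function such that any finite vector $(r(z^{(1)}),\dots,r(z^{(\ell)}))$ is (possibly degenerate) multivariate normal with mean vector $(m_\psi(z^{(i)}))_i$ and covariance matrix $(k_\psi(z^{(i)},z^{(j)}))_{i,j}$; a Gaussian process is centered if its mean function is identically zero. $\mathbb{E}_{\mathcal{GP}}$ denotes expectation with respect to the law of the Gaussian process. ''Positive definite kernel'' means symmetric with all Gram matrices positive semidefinite. $L^2(\mathcal{GP})$ is the completion of $\mathrm{span}(\{1\}\cup\{r(z): z\in\mathcal{Z}\})$ with respect to the norm $\|X\|_{L^2(\mathcal{GP})}=\mathbb{E}_{\mathcal{GP}}[X^2]^{1/2}$. *)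

(* Defs.v *)
From HB Require Import structures.
From mathcomp Require Import all_boot all_order all_algebra.
From mathcomp Require Import all_classical all_reals all_analysis.
From mathcomp Require Import measurable_realfun.

Set Implicit Arguments.
Unset Strict Implicit.
Unset Printing Implicit Defensive.
Import Order.TTheory GRing.Theory Num.Theory.
Import numFieldNormedType.Exports.

Local Open Scope classical_set_scope.
Local Open Scope ring_scope.

Definition psd (R : realType) (l : nat) (M : 'M[R]_l) : Prop :=
  forall c : 'rV[R]_l, 0 <= (c *m M *m c^T) 0 0.

Definition gram (R : realType) (I : Type) (k : I -> I -> R) (l : nat)
    (z : 'I_l -> I) : 'M[R]_l :=
  \matrix_(i, j) k (z i) (z j).

Definition posdef_kernel (R : realType) (I : Type) (k : I -> I -> R) : Prop :=
  (forall x y, k x y = k y x) /\ (forall l (z : 'I_l -> I), psd (gram k z)).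

Section gaussian.
Context d (T : measurableType d) (R : realType) (P : probability T R).

(* The degenerate case is separate because [normal_prob m 0] is a junk value
   (a uniform law), not the point mass at [m]. *)
Definition is_normal (X : {RV P >-> R}) : Prop :=
  exists m s : R, 0 <= s /\
    forall B : set R, measurable B ->
      distribution P X B = if s == 0 then \d_m B else normal_prob m s B.

(* A random vector is (possibly degenerate) multivariate normal when all the
   linear combinations of its entries are (possibly degenerate) normal. *)
Definition multivariate_normal (l : nat) (X : 'I_l -> {RV P >-> R})
    (mu : 'rV[R]_l) (Sigma : 'M[R]_l) : Prop :=
  [/\ forall c : 'rV[R]_l, is_normal (\sum_i c 0 i *: X i),
      forall i, 'E_P[X i]%E = (mu 0 i)%:E &
      forall i j, covariance P (X i) (X j) = (Sigma i j)%:E].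

Definition gaussian_process (I : Type) (X : I -> {RV P >-> R})
    (m : I -> R) (k : I -> I -> R) : Prop :=
  forall l (z : 'I_l -> I),
    multivariate_normal (fun i => X (z i)) (\row_i m (z i)) (gram k z).

Definition L2_cvg (u : nat -> {RV P >-> R}) (X : {RV P >-> R}) : Prop :=
  'N[P]_2%:E [EFin \o (u n - X)%R]%E @[n --> \oo] --> 0%E.

Definition gp_span (I : Type) (r : I -> {RV P >-> R}) : set {RV P >-> R} :=
  [set X : {RV P >-> R} | exists (a : R) (l : nat) (c : 'I_l -> R) (z : 'I_l -> I),
     forall w, X w = a + \sum_i c i * r (z i) w].

(* The completion of the span for the L^2 norm, realised as its closure in
   L^2(P); elements are random variables, identified only up to a.s. equality. *)
Definition L2GP (I : Type) (r : I -> {RV P >-> R}) : set {RV P >-> R} :=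
  [set X : {RV P >-> R} | (X : T -> R) \in Lfun P 2%:E /\
     exists u, (forall n, gp_span r (u n)) /\ L2_cvg u X].

End gaussian.

Inductive episode (S A : Type) : Type :=
| FiniteEpisode (n : nat) of ('I_n -> S * A)
| InfiniteEpisode of (nat -> S * A).

(* [None] at the times where the episode is not defined. *)
Definition at_time (S A : Type) (e : episode S A) (t : nat) : option (S * A) :=
  match e with
  | FiniteEpisode n z => omap z (insub t)
  | InfiniteEpisode z => Some (z t)
  end.

Section functional.
Context d (T : measurableType d) (R : realType) (P : probability T R).
Variables (S A : Type) (gamma : R) (r : S * A -> {RV P >-> R}).
Implicit Types (e : episode S A) (x : nat -> {RV P >-> R}) (X : {RV P >-> R}).

(* [X] is the sum of the [x t] over the times [t] of [e]. *)
Definition is_time_sum e x X : Prop :=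
  match e with
  | FiniteEpisode n _ => X = \sum_(t < n) x t
  | InfiniteEpisode _ => L2_cvg (fun n => \sum_(t < n) x t) X
  end.

(* A version of the sum; it is 0 when the series does not converge. *)
Definition time_sum e x : {RV P >-> R} := xget 0 [set X | is_time_sum e x X].

Definition reward e (u : nat) : {RV P >-> R} := oapp r 0 (at_time e u).

Definition return_term e (t u : nat) : {RV P >-> R} :=
  if (t <= u)%N then gamma ^+ (u - t) *: reward e u else 0.

Definition return_ e (t : nat) : {RV P >-> R} := time_sum e (return_term e t).

Definition F_term e (t : nat) : {RV P >-> R} :=
  gamma ^+ t *: (return_ e t - (cst (fine 'E_P[return_ e t]%E) : {RV P >-> R})).

Definition F_GP e : {RV P >-> R} := time_sum e (F_term e).

End functional.

Section kernel.
Context (R : realType) (S A : Type) (gamma : R) (k : S * A -> S * A -> R).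
Implicit Types e : episode S A.

Definition K_term e e' (t u : nat) : R :=
  match at_time e t, at_time e' u with
  | Some z, Some z' => (1 + t%:R) * (1 + u%:R) * gamma ^+ (t + u) * k z z'
  | _, _ => 0
  end.

(* Iterated form of the double series; for a family that is summable over
   [nat * nat] it is the unordered sum. *)
Definition K_GP e e' : R :=
  limn (series (fun t => limn (series (K_term e e' t)))).

End kernel.

(* Main.v *)
(* A series of random variables whose L^2 norms decay geometrically converges
   almost surely, and in L^2 by Fatou, so the returns and the functional exist.  Exchanging the two summations turns the partial
   sums of the functional into sum_{u<n} (1+u) gamma^u (r(z_u) - E r(z_u)), up to
   an error of order n gamma^n in L^2; hence mean and covariance follow from
   the continuity of the L^2 inner product.  Gaussianity passes to L^2 limits:
   the parameters (m_n, s_n) converge because they are the mean and, up to a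
   universal constant, the standard deviation; Fatou applied to the densities
   gives N(m,s)(B) <= liminf N(m_n,s_n)(B) for all B, and comparing half-lines
   with the limit identifies its law. *)
Require Import Defs.
From HB Require Import structures.
From mathcomp Require Import all_boot all_order all_algebra.
From mathcomp Require Import all_classical all_reals all_analysis.
From mathcomp Require Import measurable_realfun.
From mathcomp Require Import ring lra.

Set Implicit Arguments.
Unset Strict Implicit.
Unset Printing Implicit Defensive.
Import Order.TTheory GRing.Theory Num.Theory.
Import numFieldNormedType.Exports.

Local Open Scope classical_set_scope.
Local Open Scope ring_scope.

(** * Normal laws *)

(** [is_normal] fixes a law without mentioning moments, whereas L^2 convergence controls only means
    and covariances. The bridge is the second moment about an arbitrary center: it is quadratic in
    the parameters, so it recovers them without integrating [x] against a density. The branch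
    [s == 0] of the definition has no density, which forces limits of variance 0 to be treated
    apart. Finite and infinite episodes share one argument: rewards are extended by 0 beyond the end
    of an episode, so every time sum is an L^2 limit of partial sums indexed by all natural numbers.
    Summations are exchanged only on finite squares, obtained by cutting every return at the same
    time as the outer sum; only the resulting error needs an estimate. *)

Section eq_probability_itvcy.
Context (R : realType).

(* [R] and [measurableTypeR R] have the same measurable sets but different
   displays; this identity transports measures from one to the other. *)
Let idR : measurableTypeR R -> R := idfun.

#[local] HB.instance Definition _ :=
  @isMeasurableFun.Build _ _ _ _ idR (@measurable_id _ _ setT).

(** Closed right half-lines are stable under intersection, generate the Borel sets, and the sets [[-
    k, +oo[] exhaust the line, so uniqueness of measures applies. *)
Lemma eq_probability_itvcy (m1 : probability R R)
    (m2 : probability (measurableTypeR R) R) :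
    (forall x, m1 `[x, +oo[%classic = m2 `[x, +oo[%classic) ->
  forall B : set R, measurable B -> m1 B = m2 B.
Proof.
move=> m12 B mB.
rewrite -[RHS]/(distribution m2 idR B).
apply: (measure_unique (@RGenCInfty.G R) (fun k => `[- k%:R, +oo[%classic)) => //.
- exact: RGenCInfty.measurableE.
- move=> _ _ [x ->] [y ->]; exists (Order.max x y).
  apply/seteqP; split=> z /=; rewrite !in_itv/= !andbT ge_max.
    by move=> [-> ->].
  by move=> /andP[-> ->].
- by move=> k; exists (- k%:R).
- rewrite -subTset => x _; exists (Num.bound `|x|) => //=.
  by rewrite in_itv/= andbT lerNl (le_trans (ler_norm _))// normrN ltW// archi_boundP.
- by move=> _ [x ->]; exact: m12.
- by move=> k; rewrite (le_lt_trans (probability_le1 _ _)) ?ltry.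
Qed.

Lemma ge0_eq_integral_measurableTypeR (m1 : probability R R)
    (m2 : probability (measurableTypeR R) R) (f : R -> \bar R) :
    (forall B : set R, measurable B -> m1 B = m2 B) ->
    measurable_fun [set: R] f -> (forall x, 0 <= f x)%E ->
  (\int[m1]_x f x = \int[m2]_x f x)%E.
Proof.
move=> m12 mf f0.
transitivity (\int[distribution m2 idR]_x f x)%E.
  by apply: eq_measure_integral => B mB _; exact: m12.
exact: ge0_integral_distribution.
Qed.

End eq_probability_itvcy.

Section affine.
Context (R : realType).
Implicit Types m s a x : R.

Lemma derive1_affine (b c : R) : (fun y : R => b + c * y)^`()%classic = cst c.
Proof.
apply/funext => x; rewrite derive1E deriveD// derive_cst add0r.
by rewrite deriveM// derive_cst scaler0 addr0 derive_id /GRing.scale/= mulr1.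
Qed.

(** The factor [c] is the Jacobian of [x |-> b + c * x]. The case [c = 1] serves translations, and
    the case [m = 0], [s = 1] of the right-hand side serves standardisation. *)
Lemma normal_pdf_affine m s b c x : 0 < c -> s != 0 ->
  normal_pdf (b + c * m) (c * s) (b + c * x) * c = normal_pdf m s x.
Proof.
move=> c0 s0; have c0' := lt0r_neq0 c0.
rewrite !normal_pdfE ?mulf_neq0// /normal_peak /normal_fun.
have -> : - (b + c * x - (b + c * m)) ^+ 2 / ((c * s) ^+ 2 *+ 2) =
    - (x - m) ^+ 2 / (s ^+ 2 *+ 2) by field; rewrite s0.
have -> : (c * s) ^+ 2 * pi *+ 2 = c ^+ 2 * (s ^+ 2 * pi *+ 2) by ring.
rewrite sqrtrM ?sqr_ge0// sqrtr_sqr gtr0_norm// invfM.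
by rewrite mulrC !mulrA divff// mul1r.
Qed.

Lemma normal_prob_shift_itvcy m s a x : s != 0 ->
  normal_prob (m + a) s `[x + a, +oo[%classic = normal_prob m s `[x, +oo[%classic.
Proof.
move=> s0; rewrite /normal_prob.
pose F := fun y : R => a + 1 * y.
have -> : x + a = F x by rewrite /F mul1r addrC.
rewrite (@increasing_ge0_integration_by_substitutiony _ F) ?derive1_affine//.
- apply: eq_integral => y _; congr EFin => /=.
  rewrite -[LHS]/(normal_pdf (m + a) s (a + 1 * y) * 1).
  by rewrite -(@normal_pdf_affine m s a 1 y)// !mul1r [m + a]addrC.
- by move=> y z _ _ yz; rewrite /F !mul1r ltrD2l.
- by move=> y _; exact: cst_continuous.
- exact: is_cvg_cst.
- exact: is_cvg_cst.
- split; first by move=> y _; exact: derivableD.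
  apply: cvg_at_right_filter; apply: cvgD; first exact: cvg_cst.
  by apply: cvgM; [exact: cvg_cst|exact: cvg_id].
- rewrite /F; under eq_fun do rewrite mul1r; exact: cvg_addrl.
- by apply: continuous_subspaceT; exact: continuous_normal_pdf.
- by move=> y _; exact: normal_pdf_ge0.
Qed.

Lemma ge0_integral_normal_affine m s (g : R -> R) : 0 < s ->
    continuous g -> (forall x, 0 <= g x) ->
  (\int[lebesgue_measure]_x (g x * normal_pdf m s x)%:E =
   \int[lebesgue_measure]_x (g (m + s * x)%R * normal_pdf 0 1 x)%:E)%E.
Proof.
move=> s0 cg g0; pose F := fun y : R => m + s * y.
rewrite (@increasing_ge0_integration_by_substitutionT _ F) ?derive1_affine//.
- apply: eq_integral => y _; congr EFin => /=.
  rewrite -[LHS]/(g (m + s * y) * normal_pdf m s (m + s * y) * s).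
  rewrite -mulrA; congr (_ * _).
  by rewrite -(@normal_pdf_affine 0 1 m s y)// ?oner_neq0// mulr0 addr0 mulr1.
- by move=> y z yz; rewrite /F ltrD2l ltr_pM2l.
- by move=> y; exact: cst_continuous.
- exact: is_cvg_cst.
- exact: is_cvg_cst.
- rewrite /F; apply: (cvg_comp _ _ (gt0_cvgMrNy s0 (@cvg_id _ _))); exact: cvg_addrl_Ny.
- rewrite /F; apply: (cvg_comp _ _ (gt0_cvgMry s0 (@cvg_id _ _))); exact: cvg_addrl.
- move=> y; apply: cvgM; [exact: cg|exact: continuous_normal_pdf (lt0r_neq0 s0) y].
- by move=> y; rewrite mulr_ge0 ?normal_pdf_ge0.
Qed.
End affine.

Section normal_integral.
Context (R : realType).
Local Open Scope ereal_scope.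
Local Notation mu := (@lebesgue_measure R).

(** The Radon-Nikodym derivative of [normal_prob m s] has the same integral as [normal_pdf m s] over
    every measurable set, so the two agree almost everywhere. *)
Lemma ge0_integral_normal_prob (m s : R) (f : R -> \bar R) :
    measurable_fun [set: R] f -> (forall x, 0 <= f x) ->
  \int[normal_prob m s]_x f x = \int[mu]_x (f x * (normal_pdf m s x)%:E).
Proof.
move=> mf f0; have ns := normal_prob_dominates m s.
rewrite -(Radon_Nikodym_SigmaFinite.change_of_variables ns)//.
have mg := measurable_int _ (integrable_normal_pdf m s).
have ig := Radon_Nikodym_SigmaFinite.f_integrable ns.
apply: ae_eq_integral => //.
- by apply: emeasurable_funM => //; exact: measurable_int ig.
- exact: emeasurable_funM.
- apply: ae_eqe_mul2l; apply: integral_ae_eq => //.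
  by move=> A _ mA; rewrite -Radon_Nikodym_SigmaFinite.f_integral.
Qed.

(* It equals 1, but only its being a constant matters: where a nondegenerate
   square-integrable normal variable exists it is positive and finite. *)
Definition std_normal_moment2 : \bar R := \int[normal_prob 0 1]_x (x ^+ 2)%:E.

Let msqr (a b : R) : measurable_fun [set: R] (fun x => ((a + b * x) ^+ 2)%:E).
Proof.
apply/measurable_EFinP; apply: measurable_funX; apply: measurable_funD => //.
Qed.

Lemma ge0_integral_normal_prob_affine (m s : R) (g : R -> R) : (0 < s)%R ->
    continuous g -> (forall x, (0 <= g x)%R) ->
  \int[normal_prob m s]_x (g x)%:E = \int[normal_prob 0 1]_x (g (m + s * x))%:E.
Proof.
move=> s0 cg g0.
have cg' : continuous (fun x => g (m + s * x)%R).
  move=> x; apply: (cvg_comp _ g); last exact: cg.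
  by apply: cvgD; [exact: cvg_cst|apply: cvgM; [exact: cvg_cst|exact: cvg_id]].
rewrite !ge0_integral_normal_prob; last 4 first.
- by apply/measurable_EFinP; exact: continuous_measurable_fun.
- by move=> x; rewrite lee_fin.
- by apply/measurable_EFinP; exact: continuous_measurable_fun.
- by move=> x; rewrite lee_fin.
under eq_integral do rewrite -EFinM.
by rewrite ge0_integral_normal_affine.
Qed.

Lemma ge0_integral_lebesgueN (f : R -> \bar R) :
    measurable_fun [set: R] f -> (forall x, 0 <= f x) ->
  \int[mu]_x f (- x)%R = \int[mu]_x f x.
Proof.
move=> mf f0; have mN : measurable_fun [set: measurableTypeR R]
    (-%R : measurableTypeR R -> measurableTypeR R).
  exact: oppr_measurable.
have := ge0_integral_pushforward mN mu measurableT mf (fun x _ => f0 x).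
rewrite preimage_setT => <-.
by apply: eq_measure_integral => //= A mA AS; exact: lebesgue_measureN.
Qed.

Let std_normal_oppr (g : R -> R) : continuous g -> (forall x, (0 <= g x)%R) ->
  \int[normal_prob 0 1]_x (g (- x))%:E = \int[normal_prob 0 1]_x (g x)%:E.
Proof.
move=> cg g0.
have cg' : continuous (fun x => g (- x)%R).
  move=> x; apply: (cvg_comp _ g); last exact: cg.
  by apply: cvgN; exact: cvg_id.
rewrite !ge0_integral_normal_prob; last 4 first.
- by apply/measurable_EFinP; exact: continuous_measurable_fun.
- by move=> x; rewrite lee_fin.
- by apply/measurable_EFinP; exact: continuous_measurable_fun.
- by move=> x; rewrite lee_fin.
rewrite -[in RHS]ge0_integral_lebesgueN; last 2 first.
- apply: emeasurable_funM.
    by apply/measurable_EFinP; exact: continuous_measurable_fun.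
  exact: measurable_int _ (integrable_normal_pdf 0 1).
- by move=> x; rewrite mule_ge0// lee_fin// normal_pdf_ge0.
apply: eq_integral => x _; congr (_ * _%:E).
by rewrite !normal_pdfE ?oner_neq0// /normal_fun !subr0 sqrrN.
Qed.

(* Averaging over the symmetry x |-> -x of N(0,1) removes the cross term, so
   that the first moment of N(0,1) is never needed. *)
Lemma normal_prob_second_moment (m s a : R) : (0 < s)%R ->
  \int[normal_prob m s]_x ((x - a) ^+ 2)%:E =
  ((m - a) ^+ 2)%:E + (s ^+ 2)%:E * std_normal_moment2.
Proof.
move=> s0; have csqr (b c : R) : continuous (fun x : R => (b + c * x) ^+ 2)%R.
  move=> x; apply: (cvg_comp _ (fun x => x ^+ 2)%R); last exact: sqr_continuous.
  by apply: cvgD; [exact: cvg_cst|apply: cvgM; [exact: cvg_cst|exact: cvg_id]].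
under eq_integral => x _.
  rewrite (_ : (x - a) ^+ 2 = (- a + 1 * x) ^+ 2)%R; last by ring.
  over.
rewrite (ge0_integral_normal_prob_affine _ s0 (csqr _ _)); last first.
  by move=> x; exact: sqr_ge0.
under eq_integral => x _.
  rewrite (_ : - a + 1 * (m + s * x) = (m - a) + s * x)%R; last by ring.
  over.
set b := (m - a)%R; set I := LHS.
have I2 : I + I = (b ^+ 2 *+ 2)%:E + (s ^+ 2 *+ 2)%:E * std_normal_moment2.
  rewrite {2}/I -(std_normal_oppr (csqr b s)); last by move=> x; exact: sqr_ge0.
  have sq0 (c e x : R) : 0 <= ((c + e * x) ^+ 2)%:E by rewrite lee_fin sqr_ge0.
  have ms := msqr b s.
  have msN : measurable_fun [set: R] (fun x => ((b + s * - x) ^+ 2)%:E).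
    by under eq_fun do rewrite mulrN -mulNr; exact: msqr.
  rewrite /I -ge0_integralD//.
  have c0 (c : R) : 0 <= (c ^+ 2 *+ 2)%:E by rewrite lee_fin mulrn_wge0// sqr_ge0.
  have m2 : measurable_fun [set: R] (fun x : R => (x ^+ 2)%:E).
    by have := msqr 0 1; under eq_fun do rewrite add0r mul1r.
  have p2 (x : R) : 0 <= (x ^+ 2)%:E by rewrite lee_fin sqr_ge0.
  rewrite /std_normal_moment2 -ge0_integralZl//.
  have -> : (b ^+ 2 *+ 2)%:E = \int[normal_prob 0 1]_x (b ^+ 2 *+ 2)%:E.
    by rewrite integral_cst//= [X in _ * X](probability_setT (normal_prob 0 1)) mule1.
  rewrite -ge0_integralD//.
  - by apply: eq_integral => x _; rewrite -EFinM -!EFinD; congr EFin; ring.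
  - by move=> x _; rewrite mule_ge0.
  - by apply: emeasurable_funM => //; exact: measurable_cst.
have s20 : (0 < s ^+ 2)%R by exact: exprn_gt0.
have h0 : 0 <= std_normal_moment2.
  by apply: integral_ge0 => x _; rewrite lee_fin sqr_ge0.
have I0 : 0 <= I by apply: integral_ge0 => x _; rewrite lee_fin sqr_ge0.
(* Halving [I2] is legitimate only for finite values, and the moment is not known to be finite; the
   infinite cases are settled one by one. *)
move: I0 I2; case: I => [i||]// _.
  case: std_normal_moment2 h0 => [c _|_|//]; last first.
    by rewrite gt0_muley ?lte_fin ?mulrn_wgt0// addey.
  by rewrite -!EFinM -!EFinD => -[h]; congr EFin; lra.
case: std_normal_moment2 h0 => [c _|_|//]; first by rewrite -!EFinM -!EFinD.
by move=> _; rewrite gt0_muley ?lte_fin// addey.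
Qed.
End normal_integral.

Section normal_rv.
Context d (T : measurableType d) (R : realType) (P : probability T R).
Implicit Types X : {RV P >-> R}.

Lemma eq_is_normal X (Y : {RV P >-> R}) : X =1 Y ->
  is_normal (P := P) X -> is_normal (P := P) Y.
Proof. by move=> /mfuneqP ->. Qed.

(** Elements of [gp_span] carry a constant term, which the linear combinations in
    [multivariate_normal] do not cover. A point mass moves with the translation; otherwise the two
    laws are compared on half-lines. *)
Lemma is_normal_shift X (a : R) :
  is_normal (P := P) X -> is_normal (P := P) (X + (cst a : {RV P >-> R})).
Proof.
move=> [m [s [s0 XE]]]; exists (m + a), s; split=> // B mB.
have preE C : (X + (cst a : {RV P >-> R})) @^-1` C = X @^-1` [set x | C (x + a)] by [].
have mC (C : set R) : measurable C -> measurable [set x : R | C (x + a)].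
  move=> mC.
  have : measurable_fun [set: R] (fun x : R => x + a) by exact: measurable_funD.
  by move=> /(_ measurableT C mC); rewrite setTI.
move: XE; have [s00 XE|sn0 XE] := eqVneq s 0.
  rewrite /distribution/= /pushforward preE.
  have /= := XE _ (mC _ mB); rewrite /distribution/= /pushforward => ->.
  by rewrite !diracE; congr (_%:R%:E); apply/idP/idP; rewrite !inE.
apply: (eq_probability_itvcy
  (m1 := distribution P (X + (cst a : {RV P >-> R})))
  (m2 := normal_prob (m + a) s)) => // x.
have := normal_prob_shift_itvcy m a (x - a) sn0; rewrite subrK => e.
apply: (etrans _ (esym e)).
rewrite -XE//.
change (P (X @^-1` [set y | `[x, +oo[%classic (y + a)]) =
        P (X @^-1` `[x - a, +oo[%classic)); congr (P (X @^-1` _)).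
by apply/seteqP; split=> y /=; rewrite !in_itv/= !andbT lerBlDr.
Qed.

Local Open Scope ereal_scope.

(** The center [a] stays free because two different centers are later used to separate [m] from
    [s]. *)
Lemma normal_second_moment X (m s : R) : (0 <= s)%R ->
    (forall B : set R, measurable B ->
      distribution P X B = if s == 0%R then \d_m B else normal_prob m s B) ->
  forall a : R, 'E_P[fun w => (X w - a) ^+ 2]%R =
    ((m - a) ^+ 2)%:E + (s ^+ 2)%:E * std_normal_moment2 R.
Proof.
move=> s0 XE a.
have msq : measurable_fun [set: R] (fun x => ((x - a) ^+ 2)%:E).
  apply/measurable_EFinP; apply: measurable_funX; exact: measurable_funB.
have -> : 'E_P[fun w => (X w - a) ^+ 2]%R = \int[distribution P X]_x ((x - a) ^+ 2)%:E.
  by rewrite ge0_integral_distribution// ?unlock// => x; rewrite lee_fin sqr_ge0.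
move: XE; have [-> XE|sn0 XE] := eqVneq s 0%R.
  rewrite (eq_measure_integral (\d_m)); last by move=> A mA _; exact: XE.
  by rewrite integral_dirac//= diracT mul1e expr0n/= mul0e adde0.
have XE' (B : set R) : measurable B -> distribution P X B = normal_prob m s B.
  exact: XE.
rewrite (ge0_eq_integral_measurableTypeR (m1 := distribution P X)
  (m2 := normal_prob m s) XE' msq); last by move=> x; rewrite lee_fin sqr_ge0.
by rewrite normal_prob_second_moment// lt_neqAle eq_sym sn0.
Qed.

End normal_rv.

(** * The L^2 norm and L^2 convergence *)

Section L2_norm.
Context d (T : measurableType d) (R : realType) (P : probability T R).
Implicit Types (X Y Z : {RV P >-> R}) (u v : nat -> {RV P >-> R}).
Local Open Scope ereal_scope.

Definition L2norm X : \bar R := 'N[P]_2%:E[EFin \o X].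

Definition inL2 X : Prop := (X : T -> R) \in Lfun P 2%:E.

Lemma L2norm_ge0 X : 0 <= L2norm X. Proof. exact: Lnorm_ge0. Qed.

Lemma inL2P X : inL2 X <-> L2norm X < +oo.
Proof.
split=> [/andP[_ /[!inE]]|Xoo] //.
by apply/andP; split; [exact: mfunP|rewrite inE].
Qed.

Lemma expectation_sqr_ge0 X : 0 <= 'E_P[fun w => X w ^+ 2]%R.
Proof. by apply: expectation_ge0 => w; exact: sqr_ge0. Qed.

Lemma L2normE X : L2norm X = sqrte 'E_P[fun w => X w ^+ 2]%R.
Proof.
rewrite -poweR12_sqrt ?expectation_sqr_ge0// /L2norm !unlock/=; congr (_ `^ _).
by apply: eq_integral => w _; rewrite powR_mulrn// real_normK// num_real.
Qed.

Lemma L2norm_leP X (c : R) : (0 <= c)%R ->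
  L2norm X <= c%:E <-> 'E_P[fun w => X w ^+ 2]%R <= (c ^+ 2)%:E.
Proof.
move=> c0; have -> : c%:E = sqrte ((c ^+ 2)%:E).
  by rewrite EFin_expe sqrte_sqr gee0_abs.
by rewrite L2normE lee_sqrt// lee_fin sqr_ge0.
Qed.

Lemma L2normD X Y : L2norm (X + Y)%R <= L2norm X + L2norm Y.
Proof. by apply: minkowski_EFin => //; rewrite ler1n. Qed.

Lemma L2normZ (a : R) X : L2norm (a *: X)%R = `|a|%:E * L2norm X.
Proof.
rewrite !L2normE -[in RHS]abse_EFin -sqrte_sqr -EFin_expe -sqrteM ?lee_fin ?sqr_ge0//.
congr sqrte; rewrite [in LHS]unlock [in RHS]unlock -ge0_integralZl//.
- by apply: eq_integral => w _; rewrite -EFinM -exprMn.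
- by apply/measurable_EFinP; exact: measurable_funX.
- by move=> w _; rewrite lee_fin sqr_ge0.
- by rewrite lee_fin sqr_ge0.
Qed.

Lemma L2normN X : L2norm (- X)%R = L2norm X.
Proof. by rewrite -scaleN1r L2normZ normrN1 mul1e. Qed.

Lemma L2norm0 : L2norm 0%R = 0.
Proof. by rewrite -(scale0r 0%R) L2normZ normr0 mul0e. Qed.

Lemma L2norm_cst (c : R) : L2norm (cst c : {RV P >-> R}) = `|c|%:E.
Proof.
rewrite L2normE -[X in expectation _ X]/(cst (c ^+ 2)%R).
by rewrite expectation_cst EFin_expe sqrte_sqr abse_EFin.
Qed.

Lemma L2norm_sum (I : Type) (s : seq I) (p : pred I) (F : I -> {RV P >-> R}) :
  L2norm (\sum_(i <- s | p i) F i)%R <= \sum_(i <- s | p i) L2norm (F i).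
Proof.
elim/big_rec2: _ => [|i y X _ h]; first by rewrite L2norm0.
by rewrite (le_trans (L2normD _ _))// leeD2l.
Qed.

Lemma inL2D X Y : inL2 X -> inL2 Y -> inL2 (X + Y)%R.
Proof.
move=> /inL2P hX /inL2P hY; apply/inL2P.
by rewrite (le_lt_trans (L2normD _ _))// lte_add_pinfty.
Qed.

Lemma inL2Z (a : R) X : inL2 X -> inL2 (a *: X)%R.
Proof.
move=> /inL2P hX; apply/inL2P; rewrite L2normZ.
by rewrite lte_mul_pinfty// lee_fin.
Qed.

Lemma inL2N X : inL2 X -> inL2 (- X)%R.
Proof. by rewrite -scaleN1r; exact: inL2Z. Qed.

Lemma inL2B X Y : inL2 X -> inL2 Y -> inL2 (X - Y)%R.
Proof. by move=> hX /inL2N; exact: inL2D. Qed.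

Lemma inL2_cst (c : R) : inL2 (cst c : {RV P >-> R}).
Proof. exact: Lfun_cst. Qed.

Lemma inL2_sum (I : Type) (s : seq I) (p : pred I) (F : I -> {RV P >-> R}) :
  (forall i, inL2 (F i)) -> inL2 (\sum_(i <- s | p i) F i)%R.
Proof.
move=> F2; elim/big_rec: _ => [|i X _ h]; first exact: (inL2_cst 0).
exact: inL2D.
Qed.

(* [fine] maps an infinite norm to 0, so [L2nm] is meaningful under [inL2]. *)
Definition L2nm X : R := fine (L2norm X).

Lemma L2nmK X : inL2 X -> (L2nm X)%:E = L2norm X.
Proof. by move=> /inL2P hX; rewrite /L2nm fineK// ge0_fin_numE// L2norm_ge0. Qed.

Lemma L2nm_ge0 X : (0 <= L2nm X)%R.
Proof. by rewrite /L2nm fine_ge0// L2norm_ge0. Qed.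

Lemma L2nmD X Y : inL2 X -> inL2 Y -> (L2nm (X + Y) <= L2nm X + L2nm Y)%R.
Proof.
move=> hX hY; rewrite -lee_fin EFinD !L2nmK//; first exact: L2normD.
exact: inL2D.
Qed.

Lemma L2nmZ (a : R) X : inL2 X -> L2nm (a *: X)%R = (`|a| * L2nm X)%R.
Proof.
move=> hX; apply: EFin_inj; rewrite EFinM !L2nmK ?L2normZ//; exact: inL2Z.
Qed.

Lemma L2nmN X : L2nm (- X)%R = L2nm X.
Proof. by rewrite /L2nm L2normN. Qed.

Lemma L2nm_distC X Y : L2nm (X - Y)%R = L2nm (Y - X)%R.
Proof. by rewrite -L2nmN opprB. Qed.

Definition inL1 X : Prop := (X : T -> R) \in Lfun P 1.

Lemma inL2_inL1 X : inL2 X -> inL1 X.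
Proof. by apply: Lfun_subset12; exact: fin_num_measure. Qed.

Lemma inL2M_inL1 X Y : inL2 X -> inL2 Y -> inL1 (X * Y)%R.
Proof. exact: Lfun2_mul_Lfun1. Qed.

Lemma inL1D X Y : inL1 X -> inL1 Y -> inL1 (X + Y)%R.
Proof. by move=> X1 Y1; rewrite /inL1 rpredD. Qed.

Definition mean X : R := fine 'E_P[X].

Lemma meanK X : inL1 X -> (mean X)%:E = 'E_P[X].
Proof. by move=> X1; rewrite /mean fineK// expectation_fin_num. Qed.

Lemma meanD_L1 X Y : inL1 X -> inL1 Y -> mean (X + Y)%R = (mean X + mean Y)%R.
Proof.
by move=> X1 Y1; rewrite /mean expectationD// fineD// expectation_fin_num.
Qed.

Lemma meanZ_L1 (a : R) X : inL1 X -> mean (a *: X)%R = (a * mean X)%R.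
Proof.
move=> X1; rewrite /mean -[a in RHS]/(fine a%:E) -fineM ?expectation_fin_num//.
rewrite -expectationZl//; congr (fine 'E_P[_]).
by apply/funext => w /=; rewrite mulrC.
Qed.

(** Cauchy-Schwarz, as the case of exponents 2 and 2 of [hoelder]. The continuity of means and
    covariances under L^2 limits rests on it. *)
Lemma normr_meanM X Y : inL2 X -> inL2 Y ->
  (`|mean (X * Y)%R| <= L2nm X * L2nm Y)%R.
Proof.
move=> X2 Y2; have XY1 := inL2M_inL1 X2 Y2.
rewrite -lee_fin EFinM !L2nmK// -abse_EFin meanK//.
have half2 : (2^-1 + 2^-1 = 1 :> R)%R by rewrite [RHS]splitr !div1r.
apply: (@le_trans _ _ 'N[P]_1[EFin \o (X \* Y)%R]); last exact: hoelder.
rewrite Lnorm1 unlock; apply: le_abse_integral => //.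
by apply/measurable_EFinP; exact: measurable_funM.
Qed.

Lemma normr_mean X : inL2 X -> (`|mean X| <= L2nm X)%R.
Proof.
move=> X2; have := normr_meanM X2 (inL2_cst 1).
rewrite [X in (_ <= _ * X)%R -> _]/L2nm L2norm_cst normr1/= mulr1.
by rewrite (_ : X * _ = X)%R//; apply/mfuneqP => w /=; rewrite mulr1.
Qed.

Lemma meanD X Y : inL2 X -> inL2 Y -> mean (X + Y)%R = (mean X + mean Y)%R.
Proof. by move=> /inL2_inL1 X1 /inL2_inL1 Y1; exact: meanD_L1. Qed.

Lemma meanZ (a : R) X : inL2 X -> mean (a *: X)%R = (a * mean X)%R.
Proof. by move=> /inL2_inL1; exact: meanZ_L1. Qed.

Lemma mean_cst (c : R) : mean (cst c : {RV P >-> R}) = c.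
Proof. by rewrite /mean expectation_cst. Qed.

Lemma meanB X Y : inL2 X -> inL2 Y -> mean (X - Y)%R = (mean X - mean Y)%R.
Proof.
move=> X2 Y2; rewrite meanD//; last exact: inL2N.
by rewrite -scaleN1r meanZ// mulN1r.
Qed.

Lemma mean_sum (I : Type) (s : seq I) (p : pred I) (F : I -> {RV P >-> R}) :
  (forall i, inL2 (F i)) ->
  mean (\sum_(i <- s | p i) F i)%R = (\sum_(i <- s | p i) mean (F i))%R.
Proof.
move=> F2; elim: s => [|i s IH]; first by rewrite !big_nil; exact: (mean_cst 0).
by rewrite !big_cons; case: ifP => // _; rewrite meanD ?IH//; exact: inL2_sum.
Qed.

End L2_norm.

Lemma cvg0_le (R : realType) (f g : nat -> R) :
    (forall n, 0 <= f n <= g n) -> g n @[n --> \oo] --> 0 ->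
  f n @[n --> \oo] --> 0.
Proof.
move=> fg; apply: (@squeeze_cvgr _ _ _ _ (fun=> 0) g f).
  exact: nearW.
exact: cvg_cst.
Qed.

Lemma cvgD0 (R : realType) (f g : nat -> R) :
    f n @[n --> \oo] --> 0 -> g n @[n --> \oo] --> 0 ->
  f n + g n @[n --> \oo] --> 0.
Proof. by move=> f0 g0; rewrite -[X in _ --> X]addr0; exact: cvgD. Qed.

Section L2_convergence.
Context d (T : measurableType d) (R : realType) (P : probability T R).
Implicit Types (X Y Z : {RV P >-> R}) (u v : nat -> {RV P >-> R}).
Local Notation L2norm := (L2norm (P := P)).
Local Notation inL2 := (inL2 (P := P)).
Local Notation L2nm := (L2nm (P := P)).
Local Notation mean := (mean (P := P)).
Local Notation L2_cvg := (L2_cvg (P := P)).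

(** [L2_cvg] is stated with extended norms and asks nothing of the limit. Convergence to 0 makes
    some norm of [u n - X] finite, and [X] is [u n] minus that difference. *)
Lemma L2_cvg_inL2 u X : (forall n, inL2 (u n)) -> L2_cvg u X -> inL2 X.
Proof.
move=> u2 /fine_cvgP[[n _ un] _].
rewrite -(subKr (u n) X); apply: inL2B => //; apply/inL2P.
by have := un n (leqnn n); rewrite fin_numElt => /andP[].
Qed.

Lemma L2_cvg_nmP u X : (forall n, inL2 (u n)) -> inL2 X ->
  L2_cvg u X <-> L2nm (u n - X) @[n --> \oo] --> 0.
Proof.
move=> u2 X2; split=> [/fine_cvgP[]//|h]; apply/fine_cvgP; split=> //.
apply: nearW => n; have := inL2B (u2 n) X2 => /inL2P.
by rewrite ge0_fin_numE// L2norm_ge0.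
Qed.

Lemma L2_cvg_close u v X : (forall n, inL2 (u n)) -> (forall n, inL2 (v n)) ->
    L2nm (v n - u n) @[n --> \oo] --> 0 -> L2_cvg u X -> L2_cvg v X.
Proof.
move=> u2 v2 vu uX; have X2 := L2_cvg_inL2 u2 uX.
apply/L2_cvg_nmP => //; move/(L2_cvg_nmP u2 X2) : uX => uX.
apply: (cvg0_le _ (cvgD0 vu uX)) => n.
rewrite L2nm_ge0/= -[v n - X](subrKA (u n)); apply: L2nmD; exact: inL2B.
Qed.

Lemma L2_cvg_cst X : inL2 X -> L2_cvg (fun=> X) X.
Proof.
move=> X2; apply/L2_cvg_nmP => //; under eq_fun do rewrite subrr.
by rewrite {1}/L2nm L2norm0; exact: cvg_cst.
Qed.

Lemma L2_cvgD u v X Y : (forall n, inL2 (u n)) -> (forall n, inL2 (v n)) ->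
    L2_cvg u X -> L2_cvg v Y -> L2_cvg (fun n => u n + v n) (X + Y).
Proof.
move=> u2 v2 uX vY; have X2 := L2_cvg_inL2 u2 uX; have Y2 := L2_cvg_inL2 v2 vY.
apply/L2_cvg_nmP; [by move=> n; exact: inL2D|exact: inL2D|].
move/(L2_cvg_nmP u2 X2) : uX => uX; move/(L2_cvg_nmP v2 Y2) : vY => vY.
apply: (cvg0_le _ (cvgD0 uX vY)) => n.
by rewrite L2nm_ge0/= opprD addrACA; apply: L2nmD; exact: inL2B.
Qed.

Lemma L2_cvgZ (a : R) u X : (forall n, inL2 (u n)) ->
    L2_cvg u X -> L2_cvg (fun n => a *: u n) (a *: X).
Proof.
move=> u2 uX; have X2 := L2_cvg_inL2 u2 uX.
apply/L2_cvg_nmP; [by move=> n; exact: inL2Z|exact: inL2Z|].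
move/(L2_cvg_nmP u2 X2) : uX => uX.
have -> : (fun n => L2nm (a *: u n - a *: X)) = (fun n => `|a| * L2nm (u n - X)).
  by apply/funext => n; rewrite -scalerBr L2nmZ//; exact: inL2B.
by rewrite -(mulr0 `|a|); apply: cvgM => //; exact: cvg_cst.
Qed.

Lemma L2_cvg_sum (I : Type) (s : seq I) (u : I -> nat -> {RV P >-> R})
    (X : I -> {RV P >-> R}) : (forall i n, inL2 (u i n)) ->
    (forall i, L2_cvg (u i) (X i)) ->
  L2_cvg (fun n => \sum_(i <- s) u i n) (\sum_(i <- s) X i).
Proof.
move=> u2 uX; elim: s => [|i s IH].
  by under eq_fun do rewrite big_nil; rewrite big_nil; exact: L2_cvg_cst (inL2_cst P 0).
under eq_fun do rewrite big_cons; rewrite big_cons.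
by apply: L2_cvgD => // n; exact: inL2_sum.
Qed.

Lemma L2_cvg_tail u X n (b : R) : (forall n, inL2 (u n)) -> L2_cvg u X ->
    (forall m, (n <= m)%N -> L2nm (u m - u n) <= b) -> L2nm (X - u n) <= b.
Proof.
move=> u2 uX h; have X2 := L2_cvg_inL2 u2 uX.
move/(L2_cvg_nmP u2 X2) : uX => uX.
have : L2nm (u m - X) + b @[m --> \oo] --> 0 + b by apply: cvgD => //; exact: cvg_cst.
rewrite add0r => /cvgr_to_ge; apply.
near=> m; rewrite -[X - u n](subrKA (u m)) L2nm_distC.
rewrite (le_trans (L2nmD _ _))//; [exact: inL2B|exact: inL2B|].
by rewrite L2nm_distC lerD2l h//; near: m; exact: nbhs_infty_ge.
Unshelve. all: by end_near. Qed.

Lemma cvg_dist_le0 (f g : nat -> R) (l : R) : (forall n, `|f n - l| <= g n) ->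
  g n @[n --> \oo] --> 0 -> f n @[n --> \oo] --> l.
Proof.
move=> fg g0; apply/cvgrPdist_lt => e e0; near=> n.
rewrite distrC (le_lt_trans (fg n))//.
rewrite (le_lt_trans (ler_norm _))//; near: n.
by have /cvgr0_norm_lt := g0; exact.
Unshelve. all: by end_near. Qed.

Lemma L2_cvg_meanM u v X Y : (forall n, inL2 (u n)) -> (forall n, inL2 (v n)) ->
    L2_cvg u X -> L2_cvg v Y -> mean (u n * v n) @[n --> \oo] --> mean (X * Y).
Proof.
move=> u2 v2 uX vY; have X2 := L2_cvg_inL2 u2 uX; have Y2 := L2_cvg_inL2 v2 vY.
move/(L2_cvg_nmP u2 X2) : uX => uX; move/(L2_cvg_nmP v2 Y2) : vY => vY.
have uX2 n := inL2B (u2 n) X2; have vY2 n := inL2B (v2 n) Y2.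
apply: (@cvg_dist_le0 _ (fun n => L2nm (u n - X) * L2nm (v n - Y) +
    L2nm (u n - X) * L2nm Y + L2nm X * L2nm (v n - Y))) => [n|].
  (* Expanding around the limits leaves three error products, each of which has a factor tending to
     0 in norm and is bounded by Cauchy-Schwarz. *)
  have -> : u n * v n = (u n - X) * (v n - Y) + (u n - X) * Y + X * (v n - Y) + X * Y.
    by rewrite -[RHS]addrA -!mulrDr !subrK -mulrDl subrK.
  have h1 := inL2M_inL1 (uX2 n) (vY2 n); have h2 := inL2M_inL1 (uX2 n) Y2.
  have h3 := inL2M_inL1 X2 (vY2 n); have h4 := inL2M_inL1 X2 Y2.
  have h12 := inL1D h1 h2; have h123 := inL1D h12 h3.
  rewrite (meanD_L1 h123 h4) (meanD_L1 h12 h3) (meanD_L1 h1 h2) addrK.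
  rewrite (le_trans (ler_normD _ _))// lerD//; last exact: normr_meanM.
  by rewrite (le_trans (ler_normD _ _))// lerD//; exact: normr_meanM.
apply: cvgD0; first apply: cvgD0.
- by rewrite -[X in _ --> X](mulr0 0); exact: cvgM.
- by rewrite -[X in _ --> X](mul0r (L2nm Y)); apply: cvgM => //; exact: cvg_cst.
- by rewrite -[X in _ --> X](mulr0 (L2nm X)); apply: cvgM => //; exact: cvg_cst.
Qed.

Lemma L2_cvg_mean u X : (forall n, inL2 (u n)) ->
    L2_cvg u X -> mean (u n) @[n --> \oo] --> mean X.
Proof.
move=> u2 uX; have X2 := L2_cvg_inL2 u2 uX.
move/(L2_cvg_nmP u2 X2) : uX => uX.
apply: cvg_dist_le0 uX => n.
by rewrite -meanB// normr_mean//; exact: inL2B.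
Qed.

Definition cov X Y : R := fine (covariance P X Y).

Let covariance_mean X Y : inL2 X -> inL2 Y ->
  covariance P X Y = (mean (X * Y) - mean X * mean Y)%:E.
Proof.
move=> X2 Y2; have X1 := inL2_inL1 X2; have Y1 := inL2_inL1 Y2.
have XY1 := Lfun2_mul_Lfun1 X2 Y2.
rewrite (covarianceE X1 Y1 XY1) EFinB EFinM (meanK X1) (meanK Y1).
by congr (_ - _)%E; rewrite (meanK (inL2M_inL1 X2 Y2)).
Qed.

Lemma covK X Y : inL2 X -> inL2 Y -> (cov X Y)%:E = covariance P X Y.
Proof. by move=> X2 Y2; rewrite /cov covariance_mean. Qed.

Lemma covE X Y : inL2 X -> inL2 Y -> cov X Y = mean (X * Y) - mean X * mean Y.
Proof. by move=> X2 Y2; rewrite /cov covariance_mean. Qed.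

Lemma L2_cvg_cov u v X Y : (forall n, inL2 (u n)) -> (forall n, inL2 (v n)) ->
    L2_cvg u X -> L2_cvg v Y -> cov (u n) (v n) @[n --> \oo] --> cov X Y.
Proof.
move=> u2 v2 uX vY; have X2 := L2_cvg_inL2 u2 uX; have Y2 := L2_cvg_inL2 v2 vY.
rewrite covE//; have -> : (fun n => cov (u n) (v n)) =
    (fun n => mean (u n * v n) - mean (u n) * mean (v n)).
  by apply/funext => n; rewrite covE.
apply: cvgB; first exact: L2_cvg_meanM.
by apply: cvgM; exact: L2_cvg_mean.
Qed.

Lemma covDl X Y Z : inL2 X -> inL2 Y -> inL2 Z -> cov (X + Y) Z = cov X Z + cov Y Z.
Proof.
move=> X2 Y2 Z2; rewrite !covE//; last exact: inL2D.
rewrite mulrDl (meanD_L1 (inL2M_inL1 X2 Z2) (inL2M_inL1 Y2 Z2)) meanD//.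
by rewrite mulrDl opprD addrACA.
Qed.

Lemma covC X Y : cov X Y = cov Y X.
Proof. by rewrite /cov covarianceC. Qed.

Lemma covZl (a : R) X Y : inL2 X -> inL2 Y -> cov (a *: X) Y = a * cov X Y.
Proof.
move=> X2 Y2; rewrite (covE (inL2Z a X2) Y2) (covE X2 Y2) (meanZ a X2).
have -> : a *: X * Y = a *: (X * Y) by apply/mfuneqP => w; exact/esym/mulrA.
by rewrite (meanZ_L1 a (inL2M_inL1 X2 Y2)) mulrBr mulrA.
Qed.

Lemma cov_cst_l (c : R) X : cov (cst c : {RV P >-> R}) X = 0.
Proof. by rewrite /cov covariance_cst_l. Qed.

Lemma cov_suml (I : Type) (s : seq I) (F : I -> {RV P >-> R}) X :
    (forall i, inL2 (F i)) -> inL2 X ->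
  cov (\sum_(i <- s) F i) X = \sum_(i <- s) cov (F i) X.
Proof.
move=> F2 X2; elim: s => [|i s IH]; first by rewrite !big_nil; exact: (cov_cst_l 0).
by rewrite !big_cons covDl ?IH//; exact: inL2_sum.
Qed.

End L2_convergence.

(** * L^2 limits of normal variables *)

Section normal_parameters.
Context d (T : measurableType d) (R : realType) (P : probability T R).
Implicit Types X : {RV P >-> R}.
Local Notation inL2 := (inL2 (P := P)).
Local Notation mean := (mean (P := P)).
Local Notation cov := (cov (P := P)).

Lemma cov_shift X (Y : {RV P >-> R}) (a b : R) : inL2 X -> inL2 Y ->
  cov (X - (cst a : {RV P >-> R})) (Y - (cst b : {RV P >-> R})) = cov X Y.
Proof.
have cB (Z W : {RV P >-> R}) (c : R) : inL2 Z -> inL2 W ->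
    cov (Z - (cst c : {RV P >-> R})) W = cov Z W.
  move=> Z2 W2; rewrite covDl//; last exact: inL2N (inL2_cst P c).
  by rewrite [X in _ + X](_ : _ = 0) ?addr0//; exact: (cov_cst_l (- c) W).
move=> X2 Y2.
have YB : inL2 (Y - (cst b : {RV P >-> R})) by exact: inL2B Y2 (inL2_cst P b).
by rewrite cB// covC cB// covC.
Qed.

Lemma expectation_sqrB X (a : R) : inL2 X ->
  ('E_P[fun w => (X w - a) ^+ 2]%R = (cov X X + (mean X - a) ^+ 2)%:E)%E.
Proof.
move=> X2; have Xa2 := inL2B X2 (inL2_cst P a).
rewrite -(cov_shift a a X2 X2) (covE Xa2 Xa2) (meanB X2 (inL2_cst P a)) mean_cst.
rewrite -expr2 subrK (meanK (inL2M_inL1 Xa2 Xa2)).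
by congr expectation; apply/funext => w; rewrite expr2.
Qed.

Lemma cov_ge0 X : 0 <= cov X X.
Proof. by rewrite fine_ge0// variance_ge0. Qed.

(** Let [V] be the variance, [y] the product of [s ^+ 2] with the standard moment and [delta] the
    difference of [m] and the mean. The second moment about [m] gives [y = V + delta ^+ 2], which
    also shows [y] finite; the one about the mean gives [V = delta ^+ 2 + y]. Hence [delta = 0]. *)
Lemma normal_parameters X (m s : R) : inL2 X -> 0 <= s ->
    (forall B : set R, measurable B ->
      distribution P X B = if s == 0 then \d_m B else normal_prob m s B) ->
  mean X = m /\ ((s ^+ 2)%:E * std_normal_moment2 R = (cov X X)%:E)%E.
Proof.
move=> X2 s0 XE; have h := normal_second_moment s0 XE.
have := h m; have := h (mean X); rewrite !expectation_sqrB// !subrr expr0n addr0 add0e.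
set y := (_ * _)%E => h1 h2; move: h1; rewrite -h2 -EFinD => -[e].
have : (m - mean X) ^+ 2 = 0 by rewrite -[mean X - m]opprB sqrrN in e; lra.
move=> /eqP; rewrite sqrf_eq0 subr_eq0 => /eqP ->; split=> //.
by rewrite subrr expr0n addr0.
Qed.

End normal_parameters.

Section normal_prob_limit.
Context (R : realType).
Implicit Types (m s : nat -> R).
Local Open Scope ereal_scope.

Lemma cvgV_neq0 (f : nat -> R) (l : R) : l != 0%R -> f n @[n --> \oo] --> l ->
  ((f n)^-1)%R @[n --> \oo] --> (l^-1)%R.
Proof. by move=> l0 fl; exact: cvgV. Qed.

Lemma cvg_normal_pdf m s (m0 s0 x : R) : (0 < s0)%R ->
    m n @[n --> \oo] --> m0 -> s n @[n --> \oo] --> s0 ->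
  normal_pdf (m n) (s n) x @[n --> \oo] --> normal_pdf m0 s0 x.
Proof.
move=> s00 mm ss.
have sgt0 : \forall n \near \oo, (0 < s n)%R by exact: (cvgr_gt s0).
(* The Gaussian formula for [normal_pdf] needs a nonzero deviation, which is guaranteed only
   eventually along [s]. *)
apply: (@cvg_trans _ ((normal_peak (s n) * normal_fun (m n) (s n) x)%R @[n --> \oo])).
  by apply: near_eq_cvg; near=> n; rewrite normal_pdfE// gt_eqF//; near: n.
rewrite normal_pdfE ?gt_eqF//.
have cMc (f : nat -> R) (l c : R) : f n @[n --> \oo] --> l ->
    (f n * c)%R @[n --> \oo] --> (l * c)%R.
  by move=> fl; apply: cvgM => //; exact: cvg_cst.
have cMn (f : nat -> R) (l : R) : f n @[n --> \oo] --> l ->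
    (f n *+ 2)%R @[n --> \oo] --> (l *+ 2)%R.
  by move=> fl; rewrite mulr2n; under eq_fun do rewrite mulr2n; exact: cvgD.
have s2 : (s n ^+ 2)%R @[n --> \oo] --> (s0 ^+ 2)%R.
  by rewrite expr2; under eq_fun do rewrite expr2; exact: cvgM.
apply: cvgM.
  rewrite /normal_peak; apply: cvgV_neq0.
    by rewrite gt_eqF// sqrtr_gt0 mulrn_wgt0// mulr_gt0 ?pi_gt0// exprn_gt0.
  apply: (cvg_comp _ (@Num.sqrt R)); last exact: sqrt_continuous.
  exact: (cMn _ _ (cMc _ _ pi s2)).
apply: (cvg_comp _ (@expR R)); last exact: continuous_expR.
apply: cvgM.
  apply: cvgN; rewrite expr2; under eq_fun do rewrite expr2.
  by apply: cvgM; apply: cvgB => //; exact: cvg_cst.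
apply: cvgV_neq0; first by rewrite gt_eqF// mulrn_wgt0// exprn_gt0.
exact: cMn.
Unshelve. all: by end_near. Qed.

Lemma normal_prob_le_limn_einf m s (m0 s0 : R) (B : set R) : (0 < s0)%R ->
    m n @[n --> \oo] --> m0 -> s n @[n --> \oo] --> s0 -> measurable B ->
  normal_prob m0 s0 B <= limn_einf (fun n => normal_prob (m n) (s n) B).
Proof.
move=> s00 mm ss mB; rewrite /normal_prob.
rewrite (eq_integral (fun x : measurableTypeR R =>
    limn_einf (fun n => (normal_pdf (m n) (s n) x)%:E))).
  apply: fatou => //.
    move=> n; apply: measurable_funTS.
    exact: measurable_int _ (integrable_normal_pdf (m n) (s n)).
  by move=> n x _; rewrite lee_fin normal_pdf_ge0.
move=> x _; have /cvg_limn_einf_sup[-> _]// :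
  (normal_pdf (m n) (s n) x)%:E @[n --> \oo] --> (normal_pdf m0 s0 x)%:E.
by apply: cvg_EFin; [exact: nearW|exact: cvg_normal_pdf].
Qed.

(** The density never exceeds its peak, so moving the endpoint by [e] adds at most the peak times
    [e]. This quantitative continuity absorbs the gap left between two half-lines when laws are
    compared in the limit. *)
Lemma normal_prob_itvcyB (m0 s0 a e : R) : (s0 != 0)%R -> (0 <= e)%R ->
  normal_prob m0 s0 `[(a - e)%R, +oo[%classic <=
  normal_prob m0 s0 `[a, +oo[%classic + (normal_peak s0 * e)%:E.
Proof.
move=> sn0 e0.
have ae : (a - e <= a)%R by rewrite lerBlDr lerDl.
have -> : `[(a - e)%R, +oo[%classic =
    `[a, +oo[%classic `|` `[(a - e)%R, a[%classic :> set R.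
  rewrite setUC -itv_bndbnd_setU// ?bnd_simp//.
rewrite measureU//=; last first.
  apply/seteqP; split=> // x /=; rewrite !in_itv/= andbT => -[ax /andP[_]].
  by rewrite ltNge ax.
rewrite leeD2l// /normal_prob.
apply: (@le_trans _ _
  (\int[lebesgue_measure]_(x in `[(a - e)%R, a[) (normal_peak s0)%:E)).
  apply: ge0_le_integral => //=.
  - by move=> x _; rewrite lee_fin normal_pdf_ge0.
  - apply: measurable_funTS; exact: measurable_int _ (integrable_normal_pdf m0 s0).
  - by move=> x _; rewrite lee_fin normal_pdf_ub.
rewrite integral_cst//= lebesgue_measure_itv/= lte_fin.
case: ifPn => _; first by rewrite -EFinB subKr.
by rewrite mule0 lee_fin mulr_ge0// normal_peak_ge0.
Qed.

End normal_prob_limit.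

Section normal_limit.
Context d (T : measurableType d) (R : realType) (P : probability T R).
Implicit Types (X Y : {RV P >-> R}) (u : nat -> {RV P >-> R}).
Local Notation inL2 := (inL2 (P := P)).
Local Notation L2nm := (L2nm (P := P)).
Local Notation mean := (mean (P := P)).
Local Notation cov := (cov (P := P)).
Local Notation L2_cvg := (L2_cvg (P := P)).
Local Open Scope ereal_scope.

Lemma chebyshev_L2 X (e : R) : (0 < e)%R -> inL2 X ->
  P [set w | (e <= `|X w|)%R] <= (L2nm X ^+ 2 / e ^+ 2)%:E.
Proof.
move=> e0 X2; have e20 : (0 < e ^+ 2)%R by exact: exprn_gt0.
have -> : (L2nm X ^+ 2 / e ^+ 2)%:E = ((e ^+ 2)^-1)%:E * (L2nm X ^+ 2)%:E.
  by rewrite -EFinM mulrC.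
rewrite lee_pdivlMl//.
have mk : (e ^+ 2)%:E * P [set w | e%:E <= `|(X w)%:E|] <=
    'E_P[(fun x => x ^+ 2)%R \o (fun x => `|x|)%R \o X].
  apply: (@markov _ _ _ P X (fun x => x ^+ 2)%R) => //.
  - by move=> r _; exact: sqr_ge0.
  - by move=> x y; rewrite !nnegrE => x0 y0; rewrite ler_sqr.
apply: le_trans mk _.
have /L2norm_leP : L2norm X <= (L2nm X)%:E by rewrite L2nmK.
move=> /(_ (L2nm_ge0 X)); apply: le_trans.
rewrite le_eqVlt; apply/orP; left; apply/eqP; congr expectation.
by apply/funext => w /=; rewrite real_normK// num_real.
Qed.

Lemma limn_einf_le (f : nat -> \bar R) (g : nat -> R) (c : \bar R) :
    c \is a fin_num -> (\forall n \near \oo, f n <= c + (g n)%:E) ->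
    g n @[n --> \oo] --> 0%R -> limn_einf f <= c.
Proof.
move=> cfin fg g0.
have cg : c + (g n)%:E @[n --> \oo] --> c.
  rewrite -[X in _ --> X]adde0; apply: cvgeD => //.
  - by rewrite fin_num_adde_defr.
  - exact: cvg_cst.
  - by apply: cvg_EFin; [exact: nearW|exact: g0].
rewrite -[leRHS](cvg_limn_einf_sup cg).1 !limn_einf_lim.
apply: lee_lim; [exact: is_cvg_einfs|exact: is_cvg_einfs|].
case: fg => N _ fg; near=> n.
apply: le_ereal_inf_tmp => _ [q /= nq <-].
have Nn : (N <= n)%N by near: n; exact: nbhs_infty_ge.
apply: (@le_trans _ _ (f q)); first by apply: ereal_inf_lbound; exists q.
by apply: fg => /=; exact: leq_trans nq.
Unshelve. all: by end_near. Qed.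

(** A square with zero integral vanishes almost everywhere, so [X] is almost surely equal to its
    mean. This supplies the degenerate branch of [is_normal]. *)
Lemma L2_cvg_dirac X : inL2 X -> cov X X = 0%R ->
  forall B : set R, measurable B -> distribution P X B = \d_(mean X) B.
Proof.
move=> X2 V0 B mB.
have := expectation_sqrB (mean X) X2; rewrite V0 subrr expr0n/= addr0 unlock => h.
have mf : measurable_fun [set: T] (fun w => ((X w - mean X) ^+ 2)%:E).
  apply/measurable_EFinP; apply: measurable_funX; exact: measurable_funB.
have /(ae_eq_integral_abs P measurableT mf) h0 :
    \int[P]_w `|((X w - mean X) ^+ 2)%:E| = 0.
  by rewrite -[RHS]h; apply: eq_integral => w _; rewrite gee0_abs// lee_fin sqr_ge0.
have Xc : {ae P, forall w, X w = mean X}.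
  apply: filterS h0 => w /(_ I) /= [] /eqP.
  by rewrite sqrf_eq0 subr_eq0 => /eqP.
have null (C : set R) : measurable C -> ~ C (mean X) -> P (X @^-1` C) = 0.
  move=> mC nC; apply: measure_negligible; first exact: measurable_funPTI.
  apply: (negligibleS _ (Xc : P.-negligible (~` [set w | X w = mean X]))).
  by move=> w /= CX; apply: contra_not nC => <-.
change (P (X @^-1` B) = \d_(mean X) B); rewrite diracE.
have [/set_mem BX|] := boolP (mean X \in B); last first.
  by rewrite notin_setE => nB; exact: null.
have mBC : measurable (~` B) by exact: measurableC.
have -> : P (X @^-1` B) = 1 - P (X @^-1` (~` B)).
  rewrite -probability_setC; last exact: measurable_funPTI mBC.
  by rewrite -preimage_setC setCK.
by rewrite null// sube0.
Qed.

Theorem L2_cvg_is_normal u X : (forall n, inL2 (u n)) ->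
    (forall n, is_normal (P := P) (u n)) -> L2_cvg u X -> is_normal (P := P) X.
Proof.
move=> u2 uN uX; have X2 := L2_cvg_inL2 u2 uX.
(* When the limit variance is 0 there is no limiting density to which Fatou could apply. *)
have [V0|V0] := eqVneq (cov X X) 0%R.
  exists (mean X), 0%R; split=> // B mB; rewrite eqxx; exact: L2_cvg_dirac.
have {}V0 : (0 < cov X X)%R by rewrite lt_neqAle eq_sym V0 cov_ge0.
have /choice[s us] n : exists sn : R, (0 <= sn)%R /\
    (sn ^+ 2)%:E * std_normal_moment2 R = (cov (u n) (u n))%:E /\
    forall B : set R, measurable B -> distribution P (u n) B =
      if sn == 0%R then \d_(mean (u n)) B else normal_prob (mean (u n)) sn B.
  have [m [sn [sn0 ms]]] := uN n; exists sn; split=> //.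
  by have [-> ->] := normal_parameters (u2 n) sn0 ms.
have uV := L2_cvg_cov u2 u2 uX uX; have um := L2_cvg_mean u2 uX.
have uV0 : \forall n \near \oo, (0 < cov (u n) (u n))%R by exact: cvgr_gt V0.
(* Some [u n] has positive finite variance, equal to [s n ^+ 2] times the moment. This excludes the
   values 0 and [+oo] for the moment. *)
have [k k0 kE] : exists2 k : R, (0 < k)%R & std_normal_moment2 R = k%:E.
  have [n _ /(_ n (leqnn n)) /= Vn] := uV0; have [sn0 [+ _]] := us n.
  have : 0 <= std_normal_moment2 R.
    by apply: integral_ge0 => x _; rewrite lee_fin sqr_ge0.
  case: std_normal_moment2 => [k|_|//].
    rewrite lee_fin le_eqVlt => /predU1P[<-|k0 _]; last by exists k.
    by rewrite mule0 => -[V]; move: Vn; rewrite -V ltxx.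
  have [s2|s2] := eqVneq (s n ^+ 2)%R 0%R.
    by rewrite s2 mul0e => -[V]; move: Vn; rewrite -V ltxx.
  by rewrite gt0_muley// lte_fin lt_neqAle eq_sym s2 sqr_ge0.
(* The same formula expresses [s n] through the variance of [u n], so convergence follows from
   continuity of the square root. *)
pose s0 := Num.sqrt (cov X X / k).
have s00 : (0 < s0)%R by rewrite sqrtr_gt0 divr_gt0.
have sE n : s n = Num.sqrt (cov (u n) (u n) / k).
  have [sn0 [+ _]] := us n; rewrite kE -EFinM => -[<-].
  by rewrite mulfK ?gt_eqF// sqrtr_sqr ger0_norm.
have ss : s n @[n --> \oo] --> s0.
  rewrite (_ : s = (fun n => Num.sqrt (cov (u n) (u n) / k))); last exact/funext.
  apply: (cvg_comp _ (@Num.sqrt R)); last exact: sqrt_continuous.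
  by apply: cvgM => //; exact: cvg_cst.
have sgt0 : \forall n \near \oo, (0 < s n)%R by exact: (cvgr_gt s0).
have uE (B : set R) : measurable B ->
    \forall n \near \oo, distribution P (u n) B = normal_prob (mean (u n)) (s n) B.
  move=> mB; near=> n; have [_ [_ ->]] := us n => //.
  by rewrite gt_eqF//; near: n.
(* [B] is kept at distance [e] from the complement of [C], so that
   {u_n in B} is contained in {X in C} up to {|u_n - X| >= e}. *)
have fat (B C : set R) (e : R) : (0 < e)%R -> measurable B -> measurable C ->
    (forall x y, B x -> ~ C y -> (e <= `|x - y|)%R) ->
    normal_prob (mean X) s0 B <= distribution P X C.
  move=> e0 mB mC BC.
  apply: le_trans (normal_prob_le_limn_einf s00 um ss mB) _.
  apply: (@limn_einf_le _ (fun n => L2nm (u n - X) ^+ 2 / e ^+ 2)%R).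
  - by rewrite fin_num_measure.
  - near=> n; have <- : distribution P (u n) B = normal_prob (mean (u n)) (s n) B.
      by near: n; exact: uE.
    apply: le_trans (leeD2l _ (chebyshev_L2 e0 (inL2B (u2 n) X2))).
    have mD : measurable [set w | (e <= `|(u n - X)%R w|)%R].
      have mN : measurable_fun [set: T] (fun w => `|(u n - X)%R w|%R).
        exact: measurableT_comp.
      have := mN measurableT `[e, +oo[%classic (measurable_itv _); rewrite setTI.
      by congr measurable; apply/seteqP; split=> w /=; rewrite in_itv/= andbT.
    have mX : measurable (X @^-1` C) by exact: measurable_funPTI mC.
    apply: (@le_trans _ _ (P (X @^-1` C `|` [set w | (e <= `|(u n - X)%R w|)%R]))).
      change (P (u n @^-1` B) <= P (X @^-1` C `|` [set w | (e <= `|(u n - X)%R w|)%R])).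
      apply: le_measure; rewrite ?inE.
      + exact: measurable_funPTI mB.
      + exact: measurableU.
      + move=> w /= Bw; have [Cw|nCw] := pselect (C (X w)); [by left|right].
        exact: BC Bw nCw.
    exact: measureU2.
  - have /(L2_cvg_nmP u2 X2) h := uX.
    have h2 : (L2nm (u n - X)%R ^+ 2)%R @[n --> \oo] --> (0 * 0 : R)%R.
      by under eq_fun do rewrite expr2; exact: cvgM.
    have : (L2nm (u n - X)%R ^+ 2 / e ^+ 2)%R @[n --> \oo] --> (0 * 0 / e ^+ 2 : R)%R.
      by apply: cvgM => //; exact: cvg_cst.
    by rewrite mul0r mul0r.
exists (mean X), s0; split; first exact: ltW.
rewrite gt_eqF//; apply: (eq_probability_itvcy (m1 := distribution P X)
  (m2 := normal_prob (mean X) s0)) => a.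
have sn0 : s0 != 0%R by rewrite gt_eqF.
have peak0 := normal_peak_gt0 sn0.
have peakE e : (normal_peak s0 * (e / normal_peak s0))%R = e.
  by rewrite mulrC divfK// gt_eqF.
(* The one-sided bound [fat] gives both inequalities: applied to left half-lines and passed to
   complements, it bounds the law of [X] on [[a, +oo[] from above; applied to right half-lines, from
   below. The gap [h] is [e] divided by the peak, so that it costs at most [e] of normal mass. *)
apply/eqP; rewrite eq_le; apply/andP; split.
  apply/lee_addgt0Pr => e e0; pose h := (e / normal_peak s0)%R.
  have h0 : (0 < h)%R by rewrite divr_gt0.
  have := normal_prob_itvcyB (mean X) a sn0 (ltW h0).
  rewrite peakE; apply: le_trans.
  have : normal_prob (mean X) s0 `]-oo, (a - h)%R[%classic <=
      distribution P X `]-oo, a[%classic.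
    apply: (fat _ _ h h0) => // x y /=; rewrite !in_itv/= => xa /negP.
    rewrite -leNgt => ay.
    by rewrite distrC ger0_norm; lra.
  have h1 : distribution P X `[a, +oo[%classic = 1 - distribution P X `]-oo, a[%classic.
    by rewrite -probability_setC// setCitvl.
  have h2 : normal_prob (mean X) s0 `[(a - h)%R, +oo[%classic =
      1 - normal_prob (mean X) s0 `]-oo, (a - h)%R[%classic.
    by rewrite -(probability_setC (normal_prob (mean X) s0))// setCitvl.
  move=> hle; apply: (@le_trans _ _ (1 - distribution P X `]-oo, a[%classic)).
    by rewrite -h1.
  apply: (@le_trans _ _ (1 - normal_prob (mean X) s0 `]-oo, (a - h)%R[%classic)).
    exact: leeB.
  by rewrite -h2.
apply/lee_addgt0Pr => e e0; pose h := (e / normal_peak s0)%R.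
have h0 : (0 < h)%R by rewrite divr_gt0.
have := normal_prob_itvcyB (mean X) (a + h) sn0 (ltW h0).
rewrite addrK peakE => /le_trans; apply.
rewrite leeD2r//; apply: (fat _ _ h h0) => // x y /=.
rewrite !in_itv/= !andbT => xa /negP; rewrite -ltNge => ay.
by rewrite ger0_norm; lra.
Unshelve. all: by end_near. Qed.

End normal_limit.

(** * Series in L^2 *)

Section L2_series.
Context d (T : measurableType d) (R : realType) (P : probability T R).
Implicit Types X : {RV P >-> R}.
Local Notation L2norm := (L2norm (P := P)).
Local Notation inL2 := (inL2 (P := P)).
Local Notation L2nm := (L2nm (P := P)).
Local Notation L2_cvg := (L2_cvg (P := P)).
Local Open Scope ereal_scope.

Lemma mfun_sumE (I : Type) (s : seq I) (p : pred I) (F : I -> {mfun T >-> R}) w :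
  (\sum_(i <- s | p i) F i)%R w = (\sum_(i <- s | p i) F i w)%R.
Proof. by elim/big_rec2: _ => [|i y X _ <-]. Qed.

Lemma integral_norm_le_L2norm X : \int[P]_w `|X w|%:E <= L2norm X.
Proof.
have half2 : (2^-1 + 2^-1 = 1 :> R)%R by rewrite [RHS]splitr !div1r.
have := @hoelder _ _ _ P X (cst 1%R) 2 2 _ _ _ _ half2.
move=> /(_ _ _ _ _); rewrite -/(L2norm X) -/(L2norm (cst 1%R : {RV P >-> R})).
rewrite L2norm_cst normr1 mule1 Lnorm1 => h.
apply: le_trans (h _ _ _ _) => //.
rewrite le_eqVlt; apply/orP; left; apply/eqP.
by apply: eq_integral => w _ /=; rewrite mulr1.
Qed.

Section series.
Variables (x : nat -> {RV P >-> R}) (c b : nat -> R).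
Hypotheses (x2 : forall t, inL2 (x t)) (xc : forall t, (L2nm (x t) <= c t)%R).
Hypothesis cb : forall n m, (n <= m)%N -> (\sum_(n <= t < m) c t <= b n)%R.
Hypothesis b0 : b n @[n --> \oo] --> 0%R.

Let S n : {RV P >-> R} := (\sum_(t < n) x t)%R.

Let S2 n : inL2 (S n). Proof. exact: inL2_sum. Qed.

Let b_ge0 n : (0 <= b n)%R.
Proof. by have := cb (leqnn n); rewrite big_geq. Qed.

Lemma L2nm_sum_nat n m : (n <= m)%N -> (L2nm (S m - S n) <= b n)%R.
Proof.
move=> nm; apply: le_trans (cb nm).
have -> : (S m - S n = \sum_(n <= t < m) x t)%R.
  have -> : (S m = S n + \sum_(n <= t < m) x t)%R.
    by rewrite /S -!(big_mkord xpredT x) -big_cat_nat.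
  by rewrite addrAC subrr add0r.
rewrite -lee_fin L2nmK; last exact: inL2_sum.
apply: le_trans (L2norm_sum _ _ _) _; rewrite -sumEFin.
by apply: lee_sum => t _; rewrite -L2nmK// lee_fin.
Qed.

(** A majorant of all partial sums. L^1 norms are at most L^2 norms, so its integral is at most
    [b 0]; the series therefore converges absolutely off a null set. *)
Let G w := \sum_(t <oo) `|x t w|%:E.

Let mG : measurable_fun [set: T] G.
Proof.
rewrite /G; apply: ge0_emeasurable_sum => [k w _ _|k _]; first by rewrite lee_fin.
by apply/measurable_EFinP; exact: measurableT_comp.
Qed.

Let G_ge0 w : 0 <= G w.
Proof. by apply: nneseries_ge0 => n _ _; rewrite lee_fin. Qed.

Let integrable_G : P.-integrable [set: T] G.
Proof.
apply/integrableP; split=> //.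
apply: (@le_lt_trans _ _ (b 0%N)%:E); last exact: ltry.
under eq_integral do rewrite gee0_abs//.
rewrite /G integral_nneseries//; last first.
  by move=> n; apply/measurable_EFinP; exact: measurableT_comp.
apply: lime_le; first by apply: is_cvg_nneseries => n _ _; exact: integral_ge0.
apply: nearW => n; apply: le_trans (_ : (\sum_(0 <= t < n) c t)%:E <= _); last first.
  by rewrite lee_fin cb.
rewrite -sumEFin; apply: lee_sum => t _.
by apply: le_trans (integral_norm_le_L2norm _) _; rewrite -L2nmK// lee_fin.
Qed.

Lemma L2_cvg_series : exists X, L2_cvg S X.
Proof.
have [N [mN PN0 GN]] := integrable_ae measurableT integrable_G.
have cvgS w : ~ N w -> cvgn (fun n => S n w).
  move=> Nw; have Gw : G w \is a fin_num.
    by apply: contrapT => nG; apply/Nw/GN => /= /(_ I).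
  have -> : (fun n => S n w) = series (fun t => x t w).
    by apply/funext => n; rewrite /series/= /S mfun_sumE big_mkord.
  apply: normed_cvg; apply: nondecreasing_is_cvgn.
    apply/nondecreasing_seqP => n; rewrite /normed_series_of !seriesEnat/=.
    rewrite big_nat_recr//=.
    by rewrite lerDl.
  exists (fine (G w)) => _ [n _ <-]; rewrite -lee_fin fineK// /series/= -sumEFin.
  by apply: nneseries_lim_ge => k _ _; rewrite lee_fin.
(* Killing the partial sums on the null set makes them converge everywhere, so that the pointwise
   limit is a genuine measurable function. *)
pose Sd n w := (S n w * \1_(~` N) w)%R.
have cvgSd w : cvgn (Sd ^~ w).
  have [Nw|Nw] := pselect (N w).
    rewrite (_ : Sd ^~ w = cst 0%R); first exact: is_cvg_cst.
    by apply/funext => n; rewrite /Sd indicE memNset ?mulr0//=; exact.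
  rewrite (_ : Sd ^~ w = (fun n => S n w)); first exact: cvgS.
  by apply/funext => n; rewrite /Sd indicE mem_set ?mulr1.
have mX : measurable_fun [set: T] (fun w => limn (Sd ^~ w)).
  apply: (measurable_fun_cvg (h := Sd)) => [m|w _]; last exact: cvgSd.
  by apply: measurable_funM => //; apply: measurable_indic; exact: measurableC.
pose X : {RV P >-> R} := mfun_Sub (mem_set mX).
have SX w : ~ N w -> S n w @[n --> \oo] --> X w.
  move=> Nw; have e : (fun n => S n w) = Sd ^~ w.
    by apply/funext => n; rewrite /Sd indicE mem_set ?mulr1.
  by rewrite e; exact: cvgSd.
have mS2 (Y : {RV P >-> R}) D : measurable D ->
    measurable_fun D (fun w => (Y w ^+ 2)%:E).
  by move=> mD; apply/measurable_funTS/measurable_EFinP; exact: measurable_funX.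
have mNC : measurable (~` N) by exact: measurableC.
(* With [n] fixed, Fatou in [m] is applied to the square of [S m - S n], whose norm is at most [b n]
   once [m] is at least [n]. *)
have XS n : L2norm (X - S n)%R <= (b n)%:E.
  apply/L2norm_leP => //; rewrite unlock.
  rewrite (ge0_negligible_integral mN measurableT)//; last 2 first.
    exact: mS2.
    by move=> w _; rewrite lee_fin sqr_ge0.
  rewrite setTD (eq_integral (fun w =>
      limn_einf (fun m => (((S m - S n)%R w) ^+ 2)%:E))).
    apply: le_trans (fatou _ _ _ _) _ => //.
    - by move=> m; exact: mS2.
    - by move=> m w _; rewrite lee_fin sqr_ge0.
    apply: (limn_einf_le (g := cst 0%R)) => //; last exact: cvg_cst.
    near=> m; rewrite adde0.
    have nm : (n <= m)%N by near: m; exact: nbhs_infty_ge.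
    apply: (@le_trans _ _ (\int[P]_w (((S m - S n)%R w) ^+ 2)%:E)).
      apply: ge0_subset_integral => //; first exact: mS2.
      by move=> w _; rewrite lee_fin sqr_ge0.
    have /(L2norm_leP _ (b_ge0 n)) : L2norm (S m - S n)%R <= (b n)%:E.
      by rewrite -L2nmK; [rewrite lee_fin L2nm_sum_nat|exact: inL2B].
    by rewrite unlock.
  move=> w /set_mem /= Nw; apply/esym/(cvg_limn_einf_sup _).1.
  apply: cvg_EFin; first exact: nearW.
  have h : (S m - S n)%R w @[m --> \oo] --> (X - S n)%R w.
    by apply: cvgB; [exact: SX|exact: cvg_cst].
  by under eq_fun do rewrite expr2; rewrite expr2; exact: cvgM.
exists X; have XS2 n : inL2 (X - S n)%R.
  by apply/inL2P; rewrite (le_lt_trans (XS n))// ltry.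
have X2 : inL2 X by rewrite -(subrK (S 0%N) X); exact: inL2D.
apply/L2_cvg_nmP => //; apply: cvg0_le b0 => n.
by rewrite L2nm_ge0/= L2nm_distC -lee_fin L2nmK.
Unshelve. all: by end_near. Qed.

End series.
End L2_series.

(** * Gaussian processes *)

Section gp_span_closed.
Context d (T : measurableType d) (R : realType) (P : probability T R).
Context (I : Type) (r : I -> {RV P >-> R}).
Implicit Types X Y : {RV P >-> R}.
Local Notation span := (gp_span (P := P) r).

Lemma gp_span_cst (a : R) : span (cst a : {RV P >-> R}).
Proof.
(* The index type may be empty, so the family over ['I_0] is defined by elimination rather than from
   an inhabitant. *)
exists a, 0%N, (fun=> 0), 
  (fun i : 'I_0 => match i with Ordinal _ h => match notF h with end end).
by move=> w; rewrite big_ord0 addr0.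
Qed.

Lemma gp_span1 z : span (r z).
Proof. by exists 0, 1%N, (fun=> 1), (fun=> z) => w; rewrite big_ord1 add0r mul1r. Qed.

Lemma gp_spanZ (a : R) X : span X -> span (a *: X).
Proof.
move=> [b [l [c [z XE]]]]; exists (a * b), l, (fun i => a * c i), z => w.
rewrite -[LHS]/(a * X w) XE mulrDr mulr_sumr; congr (_ + _).
by apply: eq_bigr => i _; rewrite mulrA.
Qed.

Lemma gp_spanD X Y : span X -> span Y -> span (X + Y).
Proof.
move=> [a [l [c [z XE]]]] [a' [l' [c' [z' YE]]]].
exists (a + a'), (l + l')%N,
  (fun i => match fintype.split i with inl j => c j | inr j => c' j end),
  (fun i => match fintype.split i with inl j => z j | inr j => z' j end) => w.
rewrite -[LHS]/(X w + Y w) XE YE big_split_ord/= addrACA; congr (_ + (_ + _)).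
  by apply: eq_bigr => i _; rewrite -[lshift _ i]/(unsplit (inl i)) unsplitK.
by apply: eq_bigr => i _; rewrite -[rshift _ i]/(unsplit (inr i)) unsplitK.
Qed.

Lemma gp_span_sum (J : Type) (s : seq J) (p : pred J) (F : J -> {RV P >-> R}) :
  (forall j, span (F j)) -> span (\sum_(j <- s | p j) F j).
Proof.
move=> sF; elim/big_rec: _ => [|j X _ sX]; first exact: (gp_span_cst 0).
exact: gp_spanD.
Qed.

Lemma gp_span_is_normal (m : I -> R) (k : I -> I -> R) X :
  gaussian_process r m k -> span X -> is_normal (P := P) X.
Proof.
move=> rGP [a [l [c [z XE]]]]; have [rN _ _] := rGP l z.
have := is_normal_shift a (rN (\row_i c i)); apply: eq_is_normal => w.
rewrite XE -[LHS]/((\sum_i (\row_i0 c i0) 0 i *: r (z i)) w + a).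
rewrite addrC mfun_sumE; congr (_ + _).
by apply: eq_bigr => i _; rewrite mxE.
Qed.

End gp_span_closed.

Section gaussian_process_moments.
Context d (T : measurableType d) (R : realType) (P : probability T R).
Context (I : Type) (r : I -> {RV P >-> R}) (m : I -> R) (k : I -> I -> R).
Hypothesis rGP : gaussian_process r m k.

Lemma gaussian_process_mean z : mean (r z) = m z.
Proof.
by have [_ /(_ 0) + _] := rGP (fun _ : 'I_1 => z); rewrite /mean => ->; rewrite mxE.
Qed.

(** Square-integrability is hidden in the covariance being a real number: the diagonal entry is the
    second moment of [r z - m z], and a constant is then added back. *)
Lemma gaussian_process_inL2 z : inL2 (r z).
Proof.
have [_ /(_ 0) Ez /(_ 0 0)] := rGP (fun _ : 'I_1 => z).
rewrite mxE unlock => Vz.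
have h : inL2 (P := P) (r z - (cst (m z) : {RV P >-> R})).
  apply/inL2P; rewrite L2normE.
  have -> : ('E_P[(fun w => (r z - (cst (m z) : {RV P >-> R})) w ^+ 2)%R] =
      (k z z)%:E)%E.
    rewrite -Vz Ez mxE/=; congr expectation; apply/funext => w; exact: expr2.
  by rewrite ltry.
rewrite -(subrK (cst (m z) : {RV P >-> R}) (r z)).
by apply: inL2D => //; exact: inL2_cst.
Qed.

Lemma gaussian_process_cov z z' : cov (r z) (r z') = k z z'.
Proof.
have [_ _ /(_ 0 1)] := rGP (fun i : 'I_2 => if i == 0 then z else z').
by rewrite /cov /= mxE => ->.
Qed.

End gaussian_process_moments.

Section centered.
Context d (T : measurableType d) (R : realType) (P : probability T R).
Implicit Types X Y : {RV P >-> R}.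
Local Notation inL2 := (inL2 (P := P)).
Local Notation L2nm := (L2nm (P := P)).

Definition centered X : {RV P >-> R} := X - (cst (mean X) : {RV P >-> R}).

Lemma centered_inL2 X : inL2 X -> inL2 (centered X).
Proof. by move=> X2; apply: inL2B => //; exact: inL2_cst. Qed.

Lemma centered_mean X : inL2 X -> mean (centered X) = 0.
Proof.
by move=> X2; rewrite meanB ?mean_cst ?subrr//; exact: inL2_cst.
Qed.

Lemma centered_cov X Y : inL2 X -> inL2 Y -> cov (centered X) (centered Y) = cov X Y.
Proof. by move=> X2 Y2; exact: cov_shift. Qed.

Lemma centeredD X Y : inL2 X -> inL2 Y -> centered (X + Y) = centered X + centered Y.
Proof.
move=> X2 Y2; apply/mfuneqP => w; rewrite /centered meanD//.
by rewrite -[LHS]/(X w + Y w - (mean X + mean Y)) opprD addrACA.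
Qed.

Lemma centeredZ (a : R) X : inL2 X -> centered (a *: X) = a *: centered X.
Proof.
move=> X2; apply/mfuneqP => w; rewrite /centered meanZ//.
by rewrite -[LHS]/(a * X w - a * mean X) -mulrBr.
Qed.

Lemma centeredB X Y : inL2 X -> inL2 Y -> centered (X - Y) = centered X - centered Y.
Proof.
move=> X2 Y2; rewrite centeredD//; last exact: inL2N.
by rewrite -(scaleN1r Y) centeredZ// scaleN1r.
Qed.

Lemma centered0 : centered 0 = 0.
Proof.
apply/mfuneqP => w; rewrite -[LHS]/(0 - mean (cst 0 : {RV P >-> R})).
by rewrite mean_cst subrr.
Qed.

Lemma centered_sum (J : Type) (s : seq J) (p : pred J) (F : J -> {RV P >-> R}) :
  (forall j, inL2 (F j)) ->
  centered (\sum_(j <- s | p j) F j) = \sum_(j <- s | p j) centered (F j).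
Proof.
move=> F2; elim: s => [|j s IH]; first by rewrite !big_nil centered0.
by rewrite !big_cons; case: ifP => // _; rewrite centeredD ?IH//; exact: inL2_sum.
Qed.

(** The triangle inequality, with the mean bounded by the norm. Only a uniform constant matters, so
    2 suffices. *)
Lemma L2nm_centered X : inL2 X -> L2nm (centered X) <= 2 * L2nm X.
Proof.
move=> X2; have X2' := inL2_cst P (mean X); have := L2nmD X2 (inL2N X2').
rewrite L2nmN => /le_trans; apply; rewrite mulr_natl mulr2n lerD2l.
by rewrite {1}/L2nm L2norm_cst/= normr_mean.
Qed.

Lemma gp_span_centered (I : Type) (r : I -> {RV P >-> R}) X :
  gp_span r X -> gp_span (P := P) r (centered X).
Proof.
move=> sX; apply: gp_spanD => //; rewrite -scaleN1r; apply: gp_spanZ.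
exact: gp_span_cst.
Qed.

End centered.

Section telescoping_series.
Context d (T : measurableType d) (R : realType) (P : probability T R).
Variables (x : nat -> {RV P >-> R}) (f : nat -> R).
Hypotheses (x2 : forall t, inL2 (x t)) (f_ge0 : forall n, 0 <= f n).
Hypothesis xf : forall t, L2nm (x t) <= f t - f t.+1.

(** Bounding each norm by a telescoping difference lets the single function [f] control both the
    terms and the tails, without summing a geometric series. *)
Let f_sum n m : (n <= m)%N -> \sum_(n <= t < m) (f t - f t.+1) <= f n.
Proof.
move=> nm; under eq_bigr do rewrite -opprB.
by rewrite sumrN telescope_sumr// opprB lerBlDr lerDl.
Qed.

Lemma L2_cvg_telescope : f n @[n --> \oo] --> 0 ->
  exists X, L2_cvg (P := P) (fun n => \sum_(t < n) x t) X.
Proof. exact: L2_cvg_series x2 xf f_sum. Qed.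

Lemma L2nm_tail_telescope X n :
  L2_cvg (P := P) (fun n => \sum_(t < n) x t) X ->
  L2nm (P := P) (X - \sum_(t < n) x t) <= f n.
Proof.
move=> xX; apply: L2_cvg_tail xX _ => [k|m nm]; first exact: inL2_sum.
exact: L2nm_sum_nat x2 xf f_sum _ _ nm.
Qed.

End telescoping_series.

(** * Returns and the functional of an episode *)

Section time_sums.
Context d (T : measurableType d) (R : realType) (P : probability T R).
Context (S A : Type).
Implicit Types (e : episode S A) (x : nat -> {RV P >-> R}) (X : {RV P >-> R}).
Local Notation inL2 := (inL2 (P := P)).
Local Notation L2_cvg := (L2_cvg (P := P)).

(** Existence of a limit is what rules out the default value 0 of [xget]; for a finite episode the
    finite sum is itself a witness. *)
Lemma time_sumP e x : (exists X, L2_cvg (fun n => \sum_(t < n) x t) X) ->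
  is_time_sum e x (time_sum e x).
Proof.
move=> xX; rewrite /time_sum; case: xgetP => [X ->//|no].
case: e no => [n z|z] no; last by have [X xX'] := xX; case: (no X).
by case: (no (\sum_(t < n) x t)).
Qed.

(** For a finite episode the partial sums are constant from its length on. From here on the two
    kinds of episodes need no distinction in limits. *)
Lemma is_time_sum_L2_cvg e x X : (forall t, inL2 (x t)) ->
    (forall t, at_time e t = None -> x t = 0) ->
  is_time_sum e x X -> L2_cvg (fun n => \sum_(t < n) x t) X.
Proof.
case: e => [n z|//] x2 x0 /= ->.
have S2 m : inL2 (\sum_(t < m) x t) by exact: inL2_sum.
refine (L2_cvg_close (fun=> S2 n) S2 _ (L2_cvg_cst (S2 n))).
apply: cvg_near_cst; near=> m.
have nm : (n <= m)%N by near: m; exact: nbhs_infty_ge.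
rewrite -!(big_mkord xpredT x) (big_cat_nat (leq0n n) nm)//= addrAC subrr add0r.
rewrite big_nat_cond big1; first by rewrite {1}/L2nm L2norm0.
by move=> t /andP[/andP[nt _] _]; apply: x0 => /=; rewrite insubF// ltnNge nt.
Unshelve. all: by end_near. Qed.

End time_sums.

Section geometric.
Context (R : realType) (gamma : R).
Hypothesis gamma01 : 0 < gamma < 1.

Let g0 : 0 < gamma. Proof. by have /andP[] := gamma01. Qed.
Let gn n : 0 <= gamma ^+ n. Proof. by rewrite exprn_ge0 ?ltW. Qed.
Let g1 : 0 < 1 - gamma. Proof. by have /andP[_] := gamma01; rewrite subr_gt0. Qed.

Lemma sum_arith_geometric_le n :
  \sum_(t < n) (1 + t%:R) * gamma ^+ t <= (1 - gamma) ^- 2.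
Proof.
(* The closed form is the derivative in [gamma] of the geometric sum of the powers up to [n]. *)
suff : \sum_(t < n) (1 + t%:R) * gamma ^+ t =
    (1 - (1 + n%:R) * gamma ^+ n + n%:R * gamma ^+ n.+1) / (1 - gamma) ^+ 2.
  move=> ->; rewrite ler_pdivrMr ?exprn_gt0// mulVf ?expf_neq0 ?gt_eqF//.
  have e : (1 + n%:R) * gamma ^+ n - n%:R * gamma ^+ n.+1 =
      gamma ^+ n + n%:R * gamma ^+ n * (1 - gamma) by rewrite exprS; ring.
  have : 0 <= gamma ^+ n + n%:R * gamma ^+ n * (1 - gamma).
    by apply: addr_ge0 => //; apply: mulr_ge0; [exact: mulr_ge0|exact: ltW].
  by rewrite -e; lra.
elim: n => [|n IH].
  by rewrite big_ord0 !mul0r addr0 addr0 expr0 mulr1 subrr mul0r.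
rewrite big_ord_recr/= IH; have g1' := lt0r_neq0 g1; rewrite -natr1 !exprS.
by field.
Qed.

Lemma cvg_geometric0 (a : R) : a * gamma ^+ n @[n --> \oo] --> 0.
Proof. by apply: cvg_geometric; rewrite gtr0_norm//; have /andP[] := gamma01. Qed.

(** The sequence is dominated by the general term of a convergent series. *)
Lemma cvg_arith_geometric0 (a : R) : a * (n%:R * gamma ^+ n) @[n --> \oo] --> 0.
Proof.
rewrite -[X in _ --> X](mulr0 a); apply: cvgM; first exact: cvg_cst.
have c : cvgn (series (fun t => (1 + t%:R) * gamma ^+ t)).
  apply: nondecreasing_is_cvgn.
    apply/nondecreasing_seqP => n; rewrite seriesSr lerDl.
    by rewrite mulr_ge0 ?gn//.
  exists ((1 - gamma) ^- 2) => _ [n _ <-].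
  by rewrite /series/= big_mkord sum_arith_geometric_le.
apply: cvg0_le (cvg_series_cvg_0 c) => n.
by apply/andP; split; [exact: mulr_ge0|apply: ler_wpM2r => //; rewrite lerDr].
Qed.

End geometric.

Section episodes.
Context d (T : measurableType d) (R : realType) (P : probability T R).
Context (S A : Type) (gamma : R) (r : S * A -> {RV P >-> R}).
Implicit Types (e : episode S A).
Local Notation inL2 := (inL2 (P := P)).
Local Notation L2nm := (L2nm (P := P)).
Local Notation L2_cvg := (L2_cvg (P := P)).
Local Notation centered := (centered (P := P)).
Local Notation gp_span := (gp_span (P := P)).
Local Notation L2GP := (L2GP (P := P)).
Hypothesis gamma01 : 0 < gamma < 1.
Variable C : R.
Hypotheses (r2 : forall z, inL2 (r z)) (rC : forall z, L2nm (r z) <= C).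
Hypothesis C0 : 0 <= C.

Let g0 : 0 < gamma. Proof. by have /andP[] := gamma01. Qed.
Let gn n : 0 <= gamma ^+ n. Proof. by rewrite exprn_ge0 ?ltW. Qed.
Let g1 : 0 < 1 - gamma. Proof. by have /andP[_] := gamma01; rewrite subr_gt0. Qed.
Let g1' : 1 - gamma != 0. Proof. exact: lt0r_neq0. Qed.

(** The sum of the geometric series of the bounds on a return. Dividing by [1 - gamma] turns
    [C * gamma ^+ n] into a difference of consecutive values of [D * gamma ^+ n]. *)
Let D : R := C / (1 - gamma).
Let D0 : 0 <= D. Proof. by rewrite /D divr_ge0 // ltW. Qed.

Lemma reward_inL2 e u : inL2 (reward r e u).
Proof. by rewrite /reward; case: at_time => //=; exact: (inL2_cst P 0). Qed.

Lemma L2nm_reward e u : L2nm (reward r e u) <= C.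
Proof.
by rewrite /reward; case: at_time => //=; rewrite {1}/L2nm L2norm0.
Qed.

Lemma gp_span_reward e u : gp_span r (reward r e u).
Proof.
by rewrite /reward; case: at_time => [z|]/=; [exact: gp_span1|exact: (gp_span_cst _ 0)].
Qed.

Local Notation rterm := (return_term gamma r).

Lemma return_term_inL2 e t u : inL2 (rterm e t u).
Proof.
rewrite /return_term; case: ifP => _; last exact: (inL2_cst P 0).
exact/inL2Z/reward_inL2.
Qed.

Lemma gp_span_return_term e t u : gp_span r (rterm e t u).
Proof.
rewrite /return_term; case: ifP => _; last exact: (gp_span_cst _ 0).
exact/gp_spanZ/gp_span_reward.
Qed.

Lemma L2nm_return_term e t u :
  L2nm (rterm e t u) <= D * gamma ^+ (u - t) - D * gamma ^+ (u.+1 - t).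
Proof.
rewrite /return_term; case: leqP => [tu|ut]; last first.
  (* Before time [t] both truncated subtractions are 0, so the bound vanishes together with the
     term. *)
  by rewrite {1}/L2nm L2norm0/= (eqP (ltnW ut)) (eqP ut) subrr.
rewrite L2nmZ; last exact: reward_inL2.
rewrite subSn// exprS [leRHS](_ : _ = gamma ^+ (u - t) * C); last first.
  by rewrite /D; field.
by rewrite ger0_norm ?gn// ler_wpM2l ?gn// L2nm_reward.
Qed.

Lemma return_term_None e t u : at_time e u = None -> rterm e t u = 0.
Proof. by rewrite /return_term /reward => ->; case: ifP => //; rewrite scaler0. Qed.

Let f t n : R := D * gamma ^+ (n - t).

Let f_ge0 t n : 0 <= f t n.
Proof. by rewrite mulr_ge0// gn. Qed.

Let f_cvg0 t : f t n @[n --> \oo] --> 0.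
Proof.
rewrite -(cvg_shiftn t).
under eq_fun do rewrite /f addnK.
exact: cvg_geometric0.
Qed.

Lemma return_is_time_sum e t : is_time_sum e (rterm e t) (return_ gamma r e t).
Proof.
apply: time_sumP; apply: (@L2_cvg_telescope _ _ _ _ _ (f t)) => //.
- exact: return_term_inL2.
- exact: L2nm_return_term.
Qed.

Lemma L2_cvg_return e t :
  L2_cvg (fun n => \sum_(u < n) rterm e t u) (return_ gamma r e t).
Proof.
apply: is_time_sum_L2_cvg (return_is_time_sum e t).
- exact: return_term_inL2.
- exact: return_term_None.
Qed.

Lemma return_inL2 e t : inL2 (return_ gamma r e t).
Proof.
apply: L2_cvg_inL2 (L2_cvg_return e t) => n.
by apply: inL2_sum => u; exact: return_term_inL2.
Qed.

Lemma L2nm_return_tail e t n :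
  L2nm (return_ gamma r e t - \sum_(u < n) rterm e t u) <= D * gamma ^+ (n - t).
Proof.
apply: (@L2nm_tail_telescope _ _ _ _ _ (f t)) (L2_cvg_return e t).
- exact: return_term_inL2.
- by [].
- exact: L2nm_return_term.
Qed.

Lemma return_None e t : at_time e t = None -> return_ gamma r e t = 0.
Proof.
case: e => [n z|z]//= tn; rewrite [LHS](return_is_time_sum (FiniteEpisode z) t).
apply: big1 => u _; rewrite /return_term; case: leqP => // tu.
by move: tn; rewrite insubT// (leq_ltn_trans tu).
Qed.

Lemma F_termE e t : F_term gamma r e t = gamma ^+ t *: centered (return_ gamma r e t).
Proof. by []. Qed.

Lemma F_term_inL2 e t : inL2 (F_term gamma r e t).
Proof. rewrite F_termE; exact/inL2Z/centered_inL2/return_inL2. Qed.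

Lemma F_term_None e t : at_time e t = None -> F_term gamma r e t = 0.
Proof. by move=> et; rewrite F_termE return_None// centered0 scaler0. Qed.

(** The 2 comes from centering the returns, the denominator again from telescoping. *)
Let D' : R := 2 * D / (1 - gamma).
Let D'0 : 0 <= D'. Proof. by apply: divr_ge0; [exact: mulr_ge0|exact: ltW]. Qed.

Lemma L2nm_F_term e t :
  L2nm (F_term gamma r e t) <= D' * gamma ^+ t - D' * gamma ^+ t.+1.
Proof.
rewrite F_termE L2nmZ; last exact/centered_inL2/return_inL2.
rewrite exprS [leRHS](_ : _ = gamma ^+ t * (2 * D)); last by rewrite /D'; field.
rewrite ger0_norm ?gn// ler_wpM2l ?gn//.
apply: le_trans (L2nm_centered (return_inL2 e t)) _; rewrite ler_wpM2l//.
(* The tail after no term at all is the whole return, whose norm is thus at most [D]. *)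
by have := L2nm_return_tail e t 0; rewrite big_ord0 subr0 sub0n expr0 mulr1.
Qed.

Lemma F_GP_is_time_sum e : is_time_sum e (F_term gamma r e) (F_GP gamma r e).
Proof.
apply: time_sumP; apply: (@L2_cvg_telescope _ _ _ _ _ (fun t => D' * gamma ^+ t)).
- exact: F_term_inL2.
- by move=> n; rewrite mulr_ge0 ?gn.
- exact: L2nm_F_term.
- exact: cvg_geometric0.
Qed.

Lemma L2_cvg_F_term e :
  L2_cvg (fun n => \sum_(t < n) F_term gamma r e t) (F_GP gamma r e).
Proof.
apply: is_time_sum_L2_cvg (F_GP_is_time_sum e).
- exact: F_term_inL2.
- exact: F_term_None.
Qed.

(* The summands left once both sums of [F_GP] are exchanged: the coefficient of
   [reward e u] is the sum over [t <= u] of [gamma ^+ t * gamma ^+ (u - t)]. *)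
Definition weighted_reward e u : {RV P >-> R} :=
  ((1 + u%:R) * gamma ^+ u) *: centered (reward r e u).

Lemma weighted_reward_inL2 e u : inL2 (weighted_reward e u).
Proof. exact/inL2Z/centered_inL2/reward_inL2. Qed.

Lemma gp_span_weighted_reward e u : gp_span r (weighted_reward e u).
Proof. exact/gp_spanZ/gp_span_centered/gp_span_reward. Qed.

(** Cutting the returns at the bound [n] of the outer sum leaves a finite square, on which the
    exchange is exact; each [u] is met by the [u.+1] times [t <= u], all with weight
    [gamma ^+ u]. *)
Lemma sum_weighted_rewardE e n :
  \sum_(u < n) weighted_reward e u =
  \sum_(t < n) gamma ^+ t *: centered (\sum_(u < n) rterm e t u).
Proof.
transitivity (\sum_(t < n) \sum_(u < n)
    if (t <= u)%N then gamma ^+ u *: centered (reward r e u) else 0); last first.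
  apply: eq_bigr => t _; rewrite centered_sum; last first.
    by move=> u; exact: return_term_inL2.
  rewrite scaler_sumr; apply: eq_bigr => u _; rewrite /return_term.
  case: leqP => tu; last by rewrite centered0 scaler0.
  rewrite centeredZ ?scalerA; last exact: reward_inL2.
  by rewrite -exprD subnKC.
rewrite exchange_big/=; apply: eq_bigr => u _.
rewrite -big_mkcond/= (big_ord_narrow (ltn_ord u)) sumr_const card_ord.
by rewrite -scaler_nat scalerA -natr1 [_ + 1]addrC.
Qed.

(** Cutting the return at time [t] costs at most [2 * D * gamma ^+ (n - t)] after centering. The
    outer weight [gamma ^+ t] makes this [2 * D * gamma ^+ n] whatever [t] is, and there are [n]
    such terms. *)
Lemma L2_cvg_weighted_reward e :
  L2_cvg (fun n => \sum_(u < n) weighted_reward e u) (F_GP gamma r e).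
Proof.
apply: L2_cvg_close (L2_cvg_F_term e).
- by move=> n; apply: inL2_sum; exact: F_term_inL2.
- by move=> n; apply: inL2_sum; exact: weighted_reward_inL2.
apply: cvg0_le (cvg_arith_geometric0 gamma01 (2 * D)) => n.
rewrite L2nm_ge0/= L2nm_distC sum_weighted_rewardE -sumrB.
have T2 t : inL2 (\sum_(u < n) rterm e t u).
  by apply: inL2_sum => u; exact: return_term_inL2.
have FT2 t :
    inL2 (gamma ^+ t *: centered (return_ gamma r e t - \sum_(u < n) rterm e t u)).
  by apply/inL2Z/centered_inL2/inL2B; [exact: return_inL2|exact: T2].
have -> : \sum_(t < n) (F_term gamma r e t -
      gamma ^+ t *: centered (\sum_(u < n) rterm e t u)) =
    \sum_(t < n) gamma ^+ t *:
      centered (return_ gamma r e t - \sum_(u < n) rterm e t u).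
  apply: eq_bigr => t _; rewrite F_termE -scalerBr; congr (_ *: _).
  by rewrite centeredB//; exact: return_inL2.
apply: (@le_trans _ _ (\sum_(t < n) 2 * D * gamma ^+ n)); last first.
  by rewrite sumr_const card_ord -[leLHS]mulr_natl mulrCA lexx.
rewrite -lee_fin -sumEFin L2nmK; last exact: inL2_sum.
apply: le_trans (L2norm_sum _ _ _) _; apply: lee_sum => t _.
have RT2 : inL2 (return_ gamma r e t - \sum_(u < n) rterm e t u).
  by apply: inL2B; [exact: return_inL2|exact: T2].
rewrite -L2nmK// lee_fin L2nmZ; last exact: centered_inL2.
rewrite ger0_norm ?gn//.
have -> : 2 * D * gamma ^+ n = gamma ^+ t * (2 * (D * gamma ^+ (n - t))).
  by rewrite -[in LHS](subnKC (ltnW (ltn_ord t))) exprD; ring.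
rewrite ler_wpM2l ?gn//.
apply: le_trans (L2nm_centered RT2) _; rewrite ler_wpM2l//.
exact: L2nm_return_tail.
Qed.

Lemma F_GP_inL2 e : inL2 (F_GP gamma r e).
Proof.
apply: L2_cvg_inL2 (L2_cvg_weighted_reward e) => n.
by apply: inL2_sum; exact: weighted_reward_inL2.
Qed.

Lemma L2GP_limit (u : nat -> {RV P >-> R}) X : (forall n, inL2 (u n)) ->
  (forall n, gp_span r (u n)) -> L2_cvg u X -> L2GP r X.
Proof. by move=> u2 us uX; split; [exact: L2_cvg_inL2 uX|exists u]. Qed.

Lemma return_L2GP e t : L2GP r (return_ gamma r e t).
Proof.
apply: L2GP_limit (L2_cvg_return e t) => n.
  by apply: inL2_sum => u; exact: return_term_inL2.
by apply: gp_span_sum => u; exact: gp_span_return_term.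
Qed.

Lemma F_GP_L2GP e : L2GP r (F_GP gamma r e).
Proof.
apply: L2GP_limit (L2_cvg_weighted_reward e) => n.
  by apply: inL2_sum; exact: weighted_reward_inL2.
by apply: gp_span_sum; exact: gp_span_weighted_reward.
Qed.

End episodes.

(** * Mean, covariance and law of the functional *)

Section covariance_kernel.
Context d (T : measurableType d) (R : realType) (P : probability T R).
Context (S A : Type) (gamma : R) (r : S * A -> {RV P >-> R}).
Context (m : S * A -> R) (k : S * A -> S * A -> R).
Implicit Types (e : episode S A).
Local Notation inL2 := (inL2 (P := P)).
Local Notation L2nm := (L2nm (P := P)).
Local Notation mean := (mean (P := P)).
Local Notation cov := (cov (P := P)).
Local Notation L2_cvg := (L2_cvg (P := P)).
Hypothesis gamma01 : 0 < gamma < 1.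
Hypothesis rGP : gaussian_process r m k.
Variable C : R.
Hypotheses (C0 : 0 <= C) (rC : forall z, L2nm (r z) <= C).

Local Notation G := (weighted_reward (P := P) gamma r).
Local Notation F := (F_GP (P := P) gamma r).

Let r2 z : inL2 (r z). Proof. exact: gaussian_process_inL2 rGP z. Qed.
Let G2 e u : inL2 (G e u). Proof. exact: weighted_reward_inL2. Qed.
Let GF e : L2_cvg (fun n => \sum_(u < n) G e u) (F e).
Proof. exact: (L2_cvg_weighted_reward gamma01 r2 rC C0 e). Qed.
Let S2 e n : inL2 (\sum_(u < n) G e u). Proof. exact: inL2_sum. Qed.
Let F2 e : inL2 (F e). Proof. exact: (F_GP_inL2 gamma01 r2 rC C0 e). Qed.

Lemma F_GP_mean e : mean (F e) = 0.
Proof.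
have h := L2_cvg_mean (S2 e) (GF e).
have e0 n : mean (\sum_(u < n) G e u) = 0.
  rewrite mean_sum//; apply: big1 => u _.
  rewrite meanZ; last exact/centered_inL2/reward_inL2.
  by rewrite centered_mean ?mulr0//; exact: reward_inL2.
rewrite (funext e0) in h.
by have /cvg_lim <- // := h; rewrite lim_cst.
Qed.

Lemma cov_weighted_reward e e' t u : cov (G e t) (G e' u) = K_term gamma k e e' t u.
Proof.
have c2 e0 v : inL2 (centered (reward r e0 v)) by exact/centered_inL2/reward_inL2.
rewrite covZl// covC covZl// covC centered_cov; [|exact: reward_inL2..].
rewrite /K_term /reward; case: at_time => [z|]/=; last first.
  by rewrite (_ : cov 0 _ = 0) ?mulr0//; exact: (cov_cst_l 0 _).
case: at_time => [z'|]/=; last first.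
  by rewrite covC (_ : cov 0 _ = 0) ?mulr0//; exact: (cov_cst_l 0 _).
by rewrite (gaussian_process_cov rGP) exprD; ring.
Qed.

(** The iterated form of [K_GP] matches two successive limits, one argument at a time: the inner
    series is the covariance of one weighted reward with [F e'], and the outer series then rebuilds
    [F e]. *)
Lemma F_GP_cov e e' : cov (F e) (F e') = K_GP gamma k e e'.
Proof.
have inner t : limn (series (K_term gamma k e e' t)) = cov (G e t) (F e').
  apply/cvg_lim => //.
  have := L2_cvg_cov (fun=> G2 e t) (S2 e') (L2_cvg_cst (G2 e t)) (GF e').
  rewrite (_ : (fun n => cov _ _) = series (K_term gamma k e e' t))//.
  apply/funext => n; rewrite covC cov_suml// /series/= big_mkord.
  by apply: eq_bigr => u _; rewrite covC cov_weighted_reward.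
rewrite /K_GP (_ : (fun t => limn _) = (fun t => cov (G e t) (F e'))); last first.
  exact/funext.
apply/esym/cvg_lim => //.
have := L2_cvg_cov (S2 e) (fun=> F2 e') (GF e) (L2_cvg_cst (F2 e')).
rewrite (_ : (fun n => cov _ _) = series (fun t => cov (G e t) (F e')))//.
by apply/funext => n; rewrite cov_suml// /series/= big_mkord.
Qed.

(** A linear combination of values of [F] is the L^2 limit of the same combination of partial sums,
    and these lie in [gp_span], hence are normal. *)
Lemma F_GP_gaussian : gaussian_process F (fun=> 0) (K_GP gamma k).
Proof.
move=> l z; split=> [c|i|i j].
- apply: (@L2_cvg_is_normal _ _ _ _ (fun n => \sum_i c 0 i *: \sum_(u < n) G (z i) u)).
  + by move=> n; apply: inL2_sum => i; apply: inL2Z; exact: inL2_sum.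
  + move=> n; apply: gp_span_is_normal rGP _; apply: gp_span_sum => i.
    by apply/gp_spanZ/gp_span_sum => u; exact: gp_span_weighted_reward.
  + apply: L2_cvg_sum => [i n|i]; first by apply: inL2Z; exact: inL2_sum.
    by apply: L2_cvgZ => // n; exact: inL2_sum.
- by rewrite mxE -meanK ?F_GP_mean//; exact: inL2_inL1.
- by rewrite mxE -covK// F_GP_cov.
Qed.

(** Absolute summability is what makes the iterated sum [K_GP] the unordered double sum. The
    majorant is a product of two arithmetico-geometric sequences; [M] enters through its absolute
    value since it may be negative when there is no state-action pair. *)
Lemma K_term_summable e e' : (exists M, forall z z', `|k z z'| <= M) ->
  summable [set: nat * nat] (fun p => (K_term gamma k e e' p.1 p.2)%:E).
Proof.
move=> [M kM].
have g0 n : 0 <= gamma ^+ n by rewrite exprn_ge0 ?ltW//; have /andP[] := gamma01.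
pose a t : R := (1 + t%:R) * gamma ^+ t; have a0 t : 0 <= a t by rewrite mulr_ge0.
pose B : R := (1 - gamma) ^- 2.
have bound (N : R) : 0 <= N -> (\esum_(t in [set: nat]) (N * a t)%:E <= (N * B)%:E)%E.
  move=> N0; rewrite -nneseries_esumT; last by move=> t; rewrite lee_fin mulr_ge0.
  apply: lime_le; first by apply: is_cvg_nneseries => t _ _; rewrite lee_fin mulr_ge0.
  apply: nearW => n; rewrite sumEFin lee_fin -mulr_sumr ler_wpM2l// big_mkord.
  exact: sum_arith_geometric_le.
rewrite /summable; apply: (@le_lt_trans _ _ (`|M| * B * B)%:E); last exact: ltry.
apply: (@le_trans _ _ (\esum_(p in [set: nat * nat]) (`|M| * a p.1 * a p.2)%:E)).
  apply: le_esum => -[t u] _ /=; rewrite lee_fin /K_term.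
  case: at_time => [z|]; last by rewrite normr0 !mulr_ge0.
  case: at_time => [z'|]; last by rewrite normr0 !mulr_ge0.
  rewrite (_ : _ * k z z' = k z z' * a t * a u); last by rewrite /a exprD; ring.
  rewrite normrM (ger0_norm (a0 u)) ler_wpM2r// normrM (ger0_norm (a0 t)) ler_wpM2r//.
  exact: le_trans (kM z z') (ler_norm M).
rewrite (_ : [set: nat * nat] = [set: nat] `*`` (fun=> [set: nat])); last first.
  by apply/seteqP; split.
rewrite -(esum_esum (a := fun t u => (`|M| * a t * a u)%:E)); last first.
  by move=> t u _ _; rewrite lee_fin !mulr_ge0.
have B0 : 0 <= B by rewrite invr_ge0 sqr_ge0.
apply: le_trans (bound (`|M| * B) _); last exact: mulr_ge0.
apply: le_esum => t _; rewrite -mulrAC; apply: bound; exact: mulr_ge0.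
Qed.

End covariance_kernel.

Theorem proposition3 (R : realType) (d : measure_display)
    (T : measurableType d) (P : probability T R) (S A : Type) (gamma : R)
    (m_psi : S * A -> R) (k_psi : S * A -> S * A -> R)
    (r : S * A -> {RV P >-> R})
    (gamma01 : 0 < gamma < 1)
    (m_bounded : exists M : R, forall z, `|m_psi z| <= M)
    (k_bounded : exists M : R, forall z z', `|k_psi z z'| <= M)
    (k_posdef : posdef_kernel k_psi)
    (r_GP : gaussian_process r m_psi k_psi) :
  [/\ forall e t, is_time_sum e (return_term gamma r e t) (return_ gamma r e t)
        /\ L2GP r (return_ gamma r e t),
      forall e, is_time_sum e (F_term gamma r e) (F_GP gamma r e)
        /\ L2GP r (F_GP gamma r e),
      forall e e' : episode S A,
        summable [set: nat * nat] (fun p => (K_term gamma k_psi e e' p.1 p.2)%:E) &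
      gaussian_process (F_GP gamma r) (fun=> 0) (K_GP gamma k_psi)].
Proof.
have r2 := gaussian_process_inL2 r_GP.
have [C C0 rC] : exists2 C, 0 <= C & forall z, L2nm (r z) <= C.
  have [Mm mM] := m_bounded; have [Mk kM] := k_bounded.
  (* The second moment of [r z] is [k_psi z z + m_psi z ^+ 2]. The radicand is nonnegative as soon
     as some [z] exists, because [k_psi z z] is a variance. *)
  exists (Num.sqrt (Mk + Mm ^+ 2)) => // z.
  rewrite -lee_fin L2nmK//; apply/L2norm_leP => //.
  have := expectation_sqrB 0 (r2 z); under eq_fun do rewrite subr0; move=> ->.
  rewrite lee_fin (gaussian_process_cov r_GP) (gaussian_process_mean r_GP) subr0.
  have h : k_psi z z + m_psi z ^+ 2 <= Mk + Mm ^+ 2.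
    rewrite lerD//; first exact: le_trans (ler_norm _) (kM z z).
    rewrite -real_normK ?num_real// lerXn2r// nnegrE//.
    exact: le_trans (mM z).
  have h0 : 0 <= k_psi z z by rewrite -(gaussian_process_cov r_GP) cov_ge0.
  by rewrite sqr_sqrtr// (le_trans _ h)// addr_ge0// sqr_ge0.
split.
- move=> e t; split; first exact: (return_is_time_sum gamma01 r2 rC C0 e t).
  exact: (return_L2GP gamma01 r2 rC C0 e t).
- move=> e; split; first exact: (F_GP_is_time_sum gamma01 r2 rC C0 e).
  exact: (F_GP_L2GP gamma01 r2 rC C0 e).
- by move=> e e'; exact: K_term_summable.
- exact: (F_GP_gaussian gamma01 r_GP C0 rC).
Qed.
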